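(* Let $T$ be a separable topological space with Borel $\sigma$-algebra $\mathcal{B}(T)$. Let $\theta=\{\theta_x : x\in T\}$ be a permanental process with kernel $\Gamma$ such that $\sup_{x\in T}\Gamma(x,x)<\infty$. Let $$d(x,y)=4\sqrt{2/3}\,\Bigl(\Gamma(x,x)+\Gamma(y,y)-2\bigl(\Gamma(x,y)\Gamma(y,x)\bigr)^{1/2}\Bigr)^{1/2}.$$ Assume that $d(x,y)$ is continuous on $T\times T$ and that there exists a probability measure $\mu$ on $\mathcal{B}(T)$ such that $$\lim_{\delta\to 0}J_{d}(\delta)=0 .$$ Then there exists a version $\theta'=\{\theta'_x : x\in T\}$ of $\theta$ that is bounded and continuous almost surely and satisfies $$\lim_{\delta\to0}\ \sup_{\substack{s,t\in T\\ d(s,t)\le\delta}}\frac{|\theta'_s-\theta'_t|}{J_d(d(s,t)/2)}\le 60\Bigl(\sup_{x\in T}\theta'_x\Bigr)^{1/2}\qquad\text{a.s.}$$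
   Context: A permanental process with kernel $\Gamma:T\times T\to\mathbb{R}$ is a real-valued nonnegative stochastic process $\theta=\{\theta_x,x\in T\}$ such that for all $n$, all $x_1,\dots,x_n\in T$ and all $\alpha_1,\dots,\alpha_n\ge 0$, $$E\Bigl(\exp\Bigl(-\tfrac12\sum_{i=1}^n\alpha_i\theta_{x_i}\Bigr)\Bigr)=\frac{1}{|I+\alpha\Gamma|^{1/2}},$$ where $|\cdot|$ is the determinant, $I$ is the $n\times n$ identity, $\alpha=\mathrm{diag}(\alpha_1,\dots,\alpha_n)$ and $\Gamma=\{\Gamma(x_i,x_j)\}_{i,j=1}^n$ ($\Gamma$ need not be symmetric or positive definite). For such kernels $\Gamma(x,x)\ge0$ and $0\le\Gamma(x,y)\Gamma(y,x)\le\Gamma(x,x)\Gamma(y,y)$ for all $x,y$, so $d$ is well defined; $d$ is not assumed to be a metric or pseudometric. $B_d(t,u)=\{s\in T: d(s,t)\le u\}$, and for the probability measure $\mu$, $$J_d(a)=J_{T,d,\mu}(a)=\sup_{t\in T}\int_0^a\Bigl(\log\frac{1}{\mu(B_d(t,u))}\Bigr)^{1/2}du .$$ Convention: $0/0=0$. A version of $\theta$ is a process $\theta'$ on the same probability space with $P(\theta'_x=\theta_x)=1$ for each $x\in T$. *)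

(* Defs.v *)
From mathcomp Require Import all_boot all_order all_algebra.
From mathcomp Require Import all_classical all_reals all_analysis.

Set Implicit Arguments.
Unset Strict Implicit.
Unset Printing Implicit Defensive.

Import Order.TTheory GRing.Theory Num.Theory.
Import numFieldNormedType.Exports.

Local Open Scope classical_set_scope.
Local Open Scope ring_scope.

Definition separable_space (T : topologicalType) : Prop :=
  exists2 D : set T, countable D & dense D.

Notation borelType T := (g_sigma_algebraType (@open T)).

(* Repetitions among the points [x i] are allowed.  Where the determinant is
   not positive, [(Num.sqrt _)^-1] is [0]; the expectation on the left being
   positive, the identity then fails, so it forces the determinants to be
   positive. *)
Definition permanental_process (R : realType) (dO : measure_display)
    (Omega : measurableType dO) (P : probability Omega R) (T : Type)
    (Gamma : T -> T -> R) (theta : T -> {RV P >-> R}) : Prop :=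
  (forall (x : T) (w : Omega), 0 <= theta x w) /\
  (forall (n : nat) (x : 'I_n -> T) (alpha : 'rV[R]_n),
    (forall i, 0 <= alpha 0 i) ->
    ('E_P[fun w => expR (- (2^-1 * \sum_(i < n) alpha 0 i * theta (x i) w))])%E =
    ((Num.sqrt (\det (1%:M + diag_mx alpha *m
                       \matrix_(i < n, j < n) Gamma (x i) (x j))))^-1)%:E).

Definition kernel_dist (R : realType) (T : Type) (Gamma : T -> T -> R)
    (x y : T) : R :=
  4 * Num.sqrt (2 / 3) *
  Num.sqrt (Gamma x x + Gamma y y - 2 * Num.sqrt (Gamma x y * Gamma y x)).

Definition dball (R : realType) (T : Type) (d : T -> T -> R) (t : T) (u : R) :
  set T := [set s | d s t <= u].

(* The integrand is [+oo] at the radii [u] for which the ball is [mu]-null: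
   in [\bar R], [0^-1 = +oo] and [lne +oo = +oo]. *)
Definition J (R : realType) (T : ptopologicalType) (d : T -> T -> R)
    (mu : probability (borelType T) R) (a : R) : \bar R :=
  ereal_sup [set (\int[lebesgue_measure]_(u in `[0%R, a])
                    sqrte (lne (mu (dball d t u))^-1))%E | t in [set: T]].

Definition is_version (R : realType) (dO : measure_display)
    (Omega : measurableType dO) (P : probability Omega R) (T : Type)
    (theta' theta : T -> {RV P >-> R}) : Prop :=
  forall x, P [set w | theta' x w = theta x w] = 1%E.

(* The division of [\bar R] satisfies [0 / 0 = 0] (as [0^-1 = +oo] and
   [0 * +oo = 0]) and [c / 0 = +oo] for [0 < c]. *)
Definition modulus_ratio (R : realType) (T : ptopologicalType)
    (d : T -> T -> R) (mu : probability (borelType T) R) (f : T -> R)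
    (delta : R) : \bar R :=
  ereal_sup [set (`|f st.1 - f st.2|%:E / J d mu (d st.1 st.2 / 2))%E
            | st in [set st : T * T | d st.1 st.2 <= delta]].

(* Main.v *)
(** Write [X = sqrt theta].  The two-point Laplace transform of [theta] involves
    [Gamma] only through [Gamma x x], [Gamma y y] and [Gamma x y * Gamma y x], so
    for a nonnegative product [(theta x, theta y)] has the law of the squares of a
    Gaussian pair, and [|X x - X y|] is dominated by a Gaussian increment; this
    gives [E exp (((X x - X y) / c)^2) <= 2] as soon as [kernel_dist x y <= 2 c].
    (The law is identified by approximating test functions with Bernstein
    polynomials in [exp (- theta / 2)].)  Since [kernel_dist] need not satisfy the
    triangle inequality, one chains with the Orlicz norm [rho] of the increments,
    a pseudometric with [rho <= kernel_dist / 2].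

    The majorizing measure [mu] is transported to the first [n] points of a dense
    sequence by nearest points, where the averages of [X] over [rho]-balls of
    dyadic radii are compared by Jensen's inequality.  The random constants have
    uniformly bounded means, so by Fatou's lemma the resulting bound
    [|X s - X t| <= 5/4 (22 J(b) + 10 b C)], for [rho s t <= 2 b], holds on the
    whole sequence with a random finite [C], and extends to a continuous version.
    With [b = d(s,t)/2] the term in [C] is absorbed because either [J(b)/b] tends
    to infinity or [T] has finitely many points up to [rho]-distance [0]; finally
    [|X s ^ 2 - X t ^ 2| <= 2 sup X * |X s - X t|]. *)

Require Import Defs.
From mathcomp Require Import all_boot all_order all_algebra.
From mathcomp Require Import all_classical all_reals all_analysis.
From mathcomp Require Import measurable_realfun ring lra.
Set Implicit Arguments.
Unset Strict Implicit.
Unset Printing Implicit Defensive.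
Import Order.TTheory GRing.Theory Num.Theory.
Import numFieldNormedType.Exports.
Local Open Scope classical_set_scope.
Local Open Scope ring_scope.

(** * Bernstein operators *)

(** For [u] in [0, 1], this is the mean of [f] at a binomial variable with parameters [n] and [u],
    computed by conditioning on one trial. The recursion avoids binomial coefficients: linearity,
    monotonicity and moments follow by induction. *)
Fixpoint bernstein (R : nzRingType) (n : nat) (f : nat -> R) (u : R) : R :=
  if n is m.+1 then
    (1 - u) * bernstein m f u + u * bernstein m (fun k => f k.+1) u
  else f 0%N.

Section bernstein_theory.
Variable R : realType.
Implicit Types (f g : nat -> R) (F : R -> R -> R) (n m : nat) (u v : R).

Lemma ler_bernstein n f g u : 0 <= u <= 1 -> (forall k, f k <= g k) ->
  bernstein n f u <= bernstein n g u.
Proof.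
move=> /andP[u0 u1]; elim: n f g => [|n IH] f g fg /=; first exact: fg.
by rewrite lerD// ler_wpM2l ?subr_ge0// IH.
Qed.

Lemma bernsteinD n f g u :
  bernstein n (fun k => f k + g k) u = bernstein n f u + bernstein n g u.
Proof. by elim: n f g => //= n IH f g; rewrite !IH; ring. Qed.

Lemma bernsteinZ n f (c : R) u :
  bernstein n (fun k => c * f k) u = c * bernstein n f u.
Proof. by elim: n f => //= n IH f; rewrite !IH; ring. Qed.

(** These are the first two binomial moments: mean [n u], variance [n u (1 - u)]. Free coefficients
    let the induction pass, since shifting [k] to [k.+1] gives another quadratic. *)
Lemma bernstein_quadratic n (a b c : R) u :
  bernstein n (fun k => a + b * k%:R + c * k%:R ^+ 2) u =
  a + b * (n%:R * u) + c * (n%:R * u * (1 - u) + (n%:R * u) ^+ 2).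
Proof.
elim: n a b c => [|n IH] a b c /=; first by ring.
rewrite IH; rewrite [X in _ + u * bernstein n X u](_ : _ =
    fun k => (a + b + c) + (b + 2 * c) * k%:R + c * k%:R ^+ 2); last first.
  by apply/funext => k; rewrite -(natr1 k); ring.
by rewrite IH -(natr1 n); ring.
Qed.

Lemma bernstein_cst n (c u : R) : bernstein n (fun=> c) u = c.
Proof. by elim: n => //= n ->; ring. Qed.

Definition bernstein2 n F u v : R :=
  bernstein n (fun i => bernstein n (fun j => F (i%:R / n%:R) (j%:R / n%:R)) v) u.

Lemma ler_bernstein2 n F G u v : 0 <= u <= 1 -> 0 <= v <= 1 ->
  (forall x y, F x y <= G x y) -> bernstein2 n F u v <= bernstein2 n G u v.
Proof. by move=> u01 v01 FG; do 2!apply: ler_bernstein => // ?. Qed.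

Lemma bernstein2D n F G u v :
  bernstein2 n (fun x y => F x y + G x y) u v =
  bernstein2 n F u v + bernstein2 n G u v.
Proof.
rewrite /bernstein2 -bernsteinD; congr bernstein; apply/funext => i.
exact: bernsteinD.
Qed.

Lemma bernstein2N n F u v :
  bernstein2 n (fun x y => - F x y) u v = - bernstein2 n F u v.
Proof.
rewrite /bernstein2 -mulN1r -bernsteinZ; congr bernstein; apply/funext => i.
by rewrite -bernsteinZ; congr bernstein; apply/funext => j; rewrite mulN1r.
Qed.

Lemma bernstein2_cst n (c u v : R) : bernstein2 n (fun _ _ => c) u v = c.
Proof.
rewrite /bernstein2 -[RHS](bernstein_cst n c u); congr bernstein.
by apply/funext => i; rewrite bernstein_cst.
Qed.

(** Chebyshev's argument: averaging the quadratic majorant over two scaled binomial variables leaves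
    [e] plus [K] times their variances, each at most [1 / n]. *)
Lemma bernstein2_dist n F u v (e K : R) : (0 < n)%N ->
  0 <= u <= 1 -> 0 <= v <= 1 -> 0 <= K ->
  (forall x y, `|F x y - F u v| <= e + K * ((x - u) ^+ 2 + (y - v) ^+ 2)) ->
  `|bernstein2 n F u v - F u v| <= e + K * 2 / n%:R.
Proof.
move=> n0 u01 v01 K0 FK.
have n0' : n%:R != 0 :> R by rewrite pnatr_eq0 -lt0n.
have key : bernstein2 n (fun x y => e + K * ((x - u) ^+ 2 + (y - v) ^+ 2)) u v =
     e + K * (u * (1 - u) + v * (1 - v)) / n%:R.
  rewrite /bernstein2 [X in bernstein n X u](_ : _ = fun i : nat =>
      (e + K * (u ^+ 2 + v * (1 - v) / n%:R)) +
      (- (2 * K * u / n%:R)) * i%:R + (K / n%:R ^+ 2) * i%:R ^+ 2); last first.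
    apply/funext => i.
    rewrite [X in bernstein n X v](_ : _ = fun j : nat =>
        (e + K * ((i%:R / n%:R - u) ^+ 2 + v ^+ 2)) +
       (- (2 * K * v / n%:R)) * j%:R + (K / n%:R ^+ 2) * j%:R ^+ 2); last first.
      by apply/funext => j; field.
    by rewrite bernstein_quadratic; field.
  by rewrite bernstein_quadratic; field.
have kv : e + K * (u * (1 - u) + v * (1 - v)) / n%:R <= e + K * 2 / n%:R.
  move: u01 v01 => /andP[? ?] /andP[? ?].
  rewrite lerD2l ler_pM2r ?invr_gt0 ?ltr0n// ler_wpM2l//; nra.
apply: le_trans kv; rewrite -key ler_norml; apply/andP; split.
  rewrite lerBrDl -bernstein2N -(bernstein2_cst n (F u v) u v) -bernstein2D.
  apply: ler_bernstein2 => // x y; rewrite lerBlDr.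
  by have := FK x y; rewrite ler_norml; lra.
rewrite lerBlDl -[X in X + _](bernstein2_cst n (F u v) u v) -bernstein2D.
apply: ler_bernstein2 => // x y.
by have := FK x y; rewrite ler_norml; lra.
Qed.

Lemma bernstein2_bound n F u v (M : R) : 0 <= u <= 1 -> 0 <= v <= 1 ->
  (forall x y, `|F x y| <= M) -> `|bernstein2 n F u v| <= M.
Proof.
move=> u01 v01 FM; rewrite ler_norml; apply/andP; split.
  rewrite -(bernstein2_cst n (- M) u v); apply: ler_bernstein2 => // x y.
  by have := FM x y; rewrite ler_norml => /andP[].
rewrite -[leRHS](bernstein2_cst n M u v); apply: ler_bernstein2 => // x y.
by have := FM x y; rewrite ler_norml => /andP[].
Qed.

(** Continuity is asked at the single point [(u, v)] because the function to which this is applied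
    involves [ln] of both coordinates, hence is controlled only where they are positive. *)
Lemma bernstein2_cvg F u v (M : R) : 0 <= u <= 1 -> 0 <= v <= 1 ->
  (forall x y, `|F x y| <= M) ->
  {for (u, v), continuous (fun xy : R * R => F xy.1 xy.2)} ->
  bernstein2 n F u v @[n --> \oo] --> F u v.
Proof.
move=> u01 v01 FM Fc.
have M0 : 0 <= M by apply: le_trans (FM 0 0).
apply/cvgrPdist_le => /= e e0.
have /cvgrPdist_le /(_ (e / 2)) := Fc.
rewrite divr_gt0// => /(_ isT) [[A B] /= [nA nB] AB].
have [d d0 dAB] : exists2 d : R, 0 < d & forall x y, `|x - u| < d ->
    `|y - v| < d -> `|F x y - F u v| <= e / 2.
  move: nA nB => /nbhs_ballP[a /= a0 aA] /nbhs_ballP[b /= b0 bB].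
  exists (Num.min a b); first by rewrite lt_min a0.
  move=> x y; rewrite !lt_min => /andP[xa _] /andP[_ yb].
  rewrite distrC; apply: (AB (x, y)); split => /=.
    by apply: aA; rewrite /ball/= distrC.
  by apply: bB; rewrite /ball/= distrC.
(* If one coordinate is at distance at least [d], then [K] times its squared distance is at least
   [2 * M], which bounds any oscillation of [F]. *)
pose K := 2 * M / d ^+ 2.
have K0 : 0 <= K by apply: divr_ge0; [exact: mulr_ge0|exact: sqr_ge0].
have FK x y : `|F x y - F u v| <= e / 2 + K * ((x - u) ^+ 2 + (y - v) ^+ 2).
  have [xd|xd] := ltP `|x - u| d; last first.
    apply: (@le_trans _ _ (2 * M)).
      by apply: le_trans (ler_normB _ _) _; have := FM x y; have := FM u v; lra.
    apply: (@le_trans _ _ (K * (x - u) ^+ 2)).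
      rewrite /K mulrAC ler_pdivlMr ?exprn_gt0// ler_wpM2l ?mulr_ge0//.
      by rewrite -(real_normK (num_real (x - u))) lerXn2r ?nnegrE// ltW.
    rewrite mulrDr; have := mulr_ge0 K0 (sqr_ge0 (y - v)); lra.
  have [yd|yd] := ltP `|y - v| d; last first.
    apply: (@le_trans _ _ (2 * M)).
      by apply: le_trans (ler_normB _ _) _; have := FM x y; have := FM u v; lra.
    apply: (@le_trans _ _ (K * (y - v) ^+ 2)).
      rewrite /K mulrAC ler_pdivlMr ?exprn_gt0// ler_wpM2l ?mulr_ge0//.
      by rewrite -(real_normK (num_real (y - v))) lerXn2r ?nnegrE// ltW.
    rewrite mulrDr; have := mulr_ge0 K0 (sqr_ge0 (x - u)); lra.
  have := dAB _ _ xd yd; have := mulr_ge0 K0 (sqr_ge0 (x - u)).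
  have := mulr_ge0 K0 (sqr_ge0 (y - v)); lra.
near=> n.
have n0 : (0 < n)%N by near: n; exact: nbhs_infty_gt.
rewrite distrC; apply: le_trans (bernstein2_dist n0 u01 v01 K0 FK) _.
suff : K * 2 / n%:R <= e / 2 by lra.
rewrite ler_pdivrMr ?ltr0n// [leRHS]mulrC -ler_pdivrMr ?divr_gt0//.
by near: n; exact: nbhs_infty_ger.
Unshelve. all: by end_near. Qed.

End bernstein_theory.

(** * Uniqueness of bivariate Laplace transforms *)

Section laplace_uniqueness.
Context {R : realType} {d1 d2 : measure_display}.
Context {O1 : measurableType d1} {O2 : measurableType d2}.
Variables (P1 : probability O1 R) (P2 : probability O2 R).
Variables (a1 b1 : O1 -> R) (a2 b2 : O2 -> R).
Hypotheses (ma1 : measurable_fun setT a1) (mb1 : measurable_fun setT b1).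
Hypotheses (ma2 : measurable_fun setT a2) (mb2 : measurable_fun setT b2).
Hypotheses (a1_ge0 : forall w, 0 <= a1 w) (b1_ge0 : forall w, 0 <= b1 w).
Hypotheses (a2_ge0 : forall w, 0 <= a2 w) (b2_ge0 : forall w, 0 <= b2 w).
Hypothesis laplaceE : forall i j : nat,
  (\int[P1]_w (expR (- (2^-1 * (i%:R * a1 w + j%:R * b1 w))))%:E =
   \int[P2]_w (expR (- (2^-1 * (i%:R * a2 w + j%:R * b2 w))))%:E)%E.

Let unexp (x : R) := expR (- (2^-1 * x)).

Let same_mean (g : R -> R -> R) : Prop :=
  [/\ P1.-integrable setT (fun w => (g (unexp (a1 w)) (unexp (b1 w)))%:E),
      P2.-integrable setT (fun w => (g (unexp (a2 w)) (unexp (b2 w)))%:E) &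
      (\int[P1]_w (g (unexp (a1 w)) (unexp (b1 w)))%:E =
       \int[P2]_w (g (unexp (a2 w)) (unexp (b2 w)))%:E)%E].

Let same_meanD g h : same_mean g -> same_mean h ->
  same_mean (fun u v => g u v + h u v).
Proof.
move=> [g1 g2 gE] [h1 h2 hE]; split.
- by under eq_fun do rewrite EFinD; exact: integrableD.
- by under eq_fun do rewrite EFinD; exact: integrableD.
by under eq_integral do rewrite EFinD; under [RHS]eq_integral do rewrite EFinD;
   rewrite !integralD// gE hE.
Qed.

Let same_meanZ g (c : R) : same_mean g -> same_mean (fun u v => c * g u v).
Proof.
move=> [g1 g2 gE]; split.
- by under eq_fun do rewrite EFinM; exact: integrableZl.
- by under eq_fun do rewrite EFinM; exact: integrableZl.
by under eq_integral do rewrite EFinM; under [RHS]eq_integral do rewrite EFinM;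
   rewrite !integralZl// gE.
Qed.

Let unexp01 x : 0 <= x -> 0 <= unexp x <= 1.
Proof.
move=> x0; rewrite expR_ge0/= -expR0 ler_expR.
by rewrite oppr_le0 mulr_ge0// invr_ge0.
Qed.

Let measurable_unexp d (O : measurableType d) (a : O -> R) :
  measurable_fun setT a -> measurable_fun setT (fun w => unexp (a w)).
Proof.
move=> ma; apply: (measurableT_comp _ ma); apply: measurableT_comp => //.
by apply: measurableT_comp => //; exact: measurable_funM.
Qed.

Let bounded_integrable d (O : measurableType d) (P : probability O R)
    (f : O -> R) (M : R) : measurable_fun setT f ->
  (forall w, `|f w| <= M) -> P.-integrable setT (fun w => (f w)%:E).
Proof.
move=> mf fM; apply: (@le_integrable _ _ _ _ _ measurableT _ (cst M%:E)).
- exact/measurable_EFinP.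
- by move=> w _; rewrite !abse_EFin lee_fin (le_trans (fM w))// ler_norm.
- exact: finite_measure_integrable_cst.
Qed.

Let monomial_bound k l x y : 0 <= x -> 0 <= y ->
  `|unexp x ^+ k * unexp y ^+ l| <= 1.
Proof.
move=> /unexp01/andP[x0 x1] /unexp01/andP[y0 y1].
rewrite ger0_norm ?mulr_ge0 ?exprn_ge0//.
by rewrite mulr_ile1 ?exprn_ge0// exprn_ile1.
Qed.

Let same_mean_monomial k l : same_mean (fun u v => u ^+ k * v ^+ l).
Proof.
split.
- apply: (@bounded_integrable _ _ _ _ 1) => [|w]; last exact: monomial_bound.
  by apply: measurable_funM; apply: measurable_funX; exact: measurable_unexp.
- apply: (@bounded_integrable _ _ _ _ 1) => [|w]; last exact: monomial_bound.
  by apply: measurable_funM; apply: measurable_funX; exact: measurable_unexp.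
- have E x y : unexp x ^+ k * unexp y ^+ l =
      expR (- (2^-1 * (k%:R * x + l%:R * y))).
    by rewrite -!expRM_natl -expRD; congr expR; ring.
  under eq_integral do rewrite E.
  by rewrite laplaceE; apply: eq_integral => w _; rewrite E.
Qed.

(** The monomial factor is carried along because each step of the recursion multiplies by [v] or
    [1 - v]; at [n = 0] only a monomial remains. *)
Let same_mean_bernstein k l n (f : nat -> R) :
  same_mean (fun u v => u ^+ k * v ^+ l * bernstein n f v).
Proof.
elim: n k l f => [|n IH] k l f /=.
  rewrite (_ : (fun _ => _) = fun u v => f 0%N * (u ^+ k * v ^+ l)).
    exact: same_meanZ.
  by apply/funext => u; apply/funext => v; rewrite mulrC.
rewrite (_ : (fun _ => _) = fun u v =>
    (u ^+ k * v ^+ l * bernstein n f v +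
      -1 * (u ^+ k * v ^+ l.+1 * bernstein n f v)) +
    u ^+ k * v ^+ l.+1 * bernstein n (fun i => f i.+1) v).
  by apply: same_meanD => //; apply: same_meanD => //; exact: same_meanZ.
by apply/funext => u; apply/funext => v; rewrite exprS; ring.
Qed.

Let same_mean_bernstein2 k n m (f : nat -> nat -> R) :
  same_mean (fun u v => u ^+ k * bernstein n (fun i => bernstein m (f i) v) u).
Proof.
elim: n k f => [|n IH] k f /=.
  rewrite (_ : (fun _ => _) = fun u v => u ^+ k * v ^+ 0 * bernstein m (f 0%N) v)//.
  by apply/funext => u; apply/funext => v; rewrite expr0 mulr1.
rewrite (_ : (fun _ => _) = fun u v =>
    (u ^+ k * bernstein n (fun i => bernstein m (f i) v) u +
      -1 * (u ^+ k.+1 * bernstein n (fun i => bernstein m (f i) v) u)) +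
    u ^+ k.+1 * bernstein n (fun i => bernstein m (f i.+1) v) u).
  apply: same_meanD; first by apply: same_meanD => //; exact: same_meanZ.
  exact: (IH _ (fun i => f i.+1)).
by apply/funext => u; apply/funext => v; rewrite exprS; ring.
Qed.

(** In the variables [unexp a], [unexp b] the hypothesis says that all mixed moments agree, hence so
    do the means of all Bernstein polynomials. Those of [F] are bounded by [M] and converge
    pointwise, so dominated convergence concludes with no condition on [h] at infinity. *)
Theorem laplace_mean_eq (h : R -> R -> R) (M : R) :
  (forall x y, `|h x y| <= M) ->
  continuous (fun xy : R * R => h xy.1 xy.2) ->
  (\int[P1]_w (h (a1 w) (b1 w))%:E = \int[P2]_w (h (a2 w) (b2 w))%:E)%E.
Proof.
move=> hM hc.
pose F (u v : R) := h (- (2 * ln u)) (- (2 * ln v)).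
have FM x y : `|F x y| <= M by exact: hM.
have unexpK x : - (2 * ln (unexp x)) = x by rewrite expRK; field.
have Fcvg x y : 0 <= x -> 0 <= y ->
    bernstein2 n F (unexp x) (unexp y) @[n --> \oo] --> h x y.
  move=> x0 y0; rewrite -{2}(unexpK x) -{2}(unexpK y).
  apply: (@bernstein2_cvg _ F _ _ M); [exact: unexp01|exact: unexp01|by []|].
  apply: (@continuous_comp _ _ _
    (fun xy : R * R => (- (2 * ln xy.1), - (2 * ln xy.2)) : R * R)
    (fun xy : R * R => h xy.1 xy.2)); last exact: hc.
  have lnc (p : R * R -> R) (q : R * R) : {for q, continuous p} -> 0 < p q ->
      - (2 * ln (p z)) @[z --> q] --> - (2 * ln (p q)).
    move=> pc pq; apply: cvgN; apply: cvgM; first exact: cvg_cst.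
    by apply: continuous_comp => //; exact: continuous_ln.
  apply: (@cvg_pair _ _ _ _ (nbhs _) (nbhs _)).
    by apply: lnc; [exact: cvg_fst|exact: expR_gt0].
  by apply: lnc; [exact: cvg_snd|exact: expR_gt0].
have sm n : same_mean (bernstein2 n F).
  have := same_mean_bernstein2 0 n n (fun i j => F (i%:R / n%:R) (j%:R / n%:R)).
  rewrite (_ : (fun _ => _) = bernstein2 n F)//.
  by apply/funext => u; apply/funext => v; rewrite expr0 mul1r.
have key d (O : measurableType d) (P : probability O R) (a b : O -> R) :
    (forall w, 0 <= a w) -> (forall w, 0 <= b w) ->
    (forall n, P.-integrable setT
       (fun w => (bernstein2 n F (unexp (a w)) (unexp (b w)))%:E)) ->
    (\int[P]_w (bernstein2 n F (unexp (a w)) (unexp (b w)))%:E @[n --> \oo]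
       --> \int[P]_w (h (a w) (b w))%:E)%E.
  move=> a0 b0 iP.
  have Bcvg w : setT w ->
      ((bernstein2 n F (unexp (a w)) (unexp (b w)))%:E @[n --> \oo] -->
       (h (a w) (b w))%:E)%E.
    by move=> _; apply/fine_cvgP; split; [exact: nearW|exact: Fcvg].
  have mB n := measurable_int _ (iP n).
  have [] := @dominated_convergence _ _ _ P setT measurableT
    (fun n w => (bernstein2 n F (unexp (a w)) (unexp (b w)))%:E)
    (fun w => (h (a w) (b w))%:E) (cst M%:E) => //.
  - exact: (emeasurable_fun_cvg _ _ mB Bcvg).
  - by apply: aeW => w; exact: Bcvg.
  - exact: finite_measure_integrable_cst.
  - apply: aeW => w n _ /=; rewrite lee_fin.
    by apply: bernstein2_bound => //; exact: unexp01.
have k1 := key _ _ P1 a1 b1 a1_ge0 b1_ge0 (fun n => let: And3 x _ _ := sm n in x).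
have k2 := key _ _ P2 a2 b2 a2_ge0 b2_ge0 (fun n => let: And3 _ x _ := sm n in x).
rewrite (_ : (fun n => _) = fun n : nat =>
  (\int[P2]_w (bernstein2 n F (unexp (a2 w)) (unexp (b2 w)))%:E)%E) in k1.
  by rewrite -(cvg_lim _ k1)// -(cvg_lim _ k2).
by apply/funext => n; have [_ _ ->] := sm n.
Qed.

End laplace_uniqueness.

(** * Comparison with Gaussian pairs *)

Section normal_exponential_moments.
Variable R : realType.
Local Notation N01 := (normal_prob (0 : R) 1).
Local Notation leb := (@lebesgue_measure R).

Lemma ge0_integral_normal_prob (m s : R) (f : R -> \bar R) :
  (forall x, 0 <= f x)%E -> measurable_fun setT f ->
  (\int[normal_prob m s]_x f x = \int[leb]_x (f x * (normal_pdf m s x)%:E))%E.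
Proof.
move=> f0 mf.
have dom := @normal_prob_dominates R m s.
rewrite -(Radon_Nikodym_SigmaFinite.change_of_variables dom f0 measurableT mf).
have iF := Radon_Nikodym_SigmaFinite.f_integrable dom.
have mF := measurable_int _ iF.
have mN : measurable_fun setT (fun x => (normal_pdf m s x)%:E).
  by apply/measurable_EFinP; exact: measurable_normal_pdf.
apply: ae_eq_integral => //.
- exact: emeasurable_funM.
- exact: emeasurable_funM.
- apply: ae_eqe_mul2l; apply: integral_ae_eq => //= E _ mE.
  by rewrite -Radon_Nikodym_SigmaFinite.f_integral.
Qed.

Lemma normal_peak_scale (s : R) : 0 < s -> normal_peak 1 = s * normal_peak s.
Proof.
move=> s0; rewrite /normal_peak expr1n mul1r -mulrnAr sqrtrM ?sqr_ge0//.
by rewrite sqrtr_sqr gtr0_norm// invfM mulrA divff ?mul1r// gt_eqF.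
Qed.

Lemma measurable_exp_quadratic (a b : R) :
  measurable_fun setT (fun x : R => expR (a * x - 2^-1 * (b * x ^+ 2))).
Proof.
apply: measurableT_comp => //; apply: measurable_funB.
  exact: measurable_funM.
by apply: measurable_funM => //; apply: measurable_funM.
Qed.

(** Completing the square turns the integrand times the standard density into a constant times the
    normal density of mean [v / (1 + u)] and variance [1 / (1 + u)]. *)
Lemma normal_exp_quadratic (u v : R) : 0 < 1 + u ->
  (\int[N01]_x (expR (v * x - 2^-1 * (u * x ^+ 2)))%:E =
   ((Num.sqrt (1 + u))^-1 * expR (v ^+ 2 / (2 * (1 + u))))%:E)%E.
Proof.
move=> u0.
have u0' : 1 + u != 0 by rewrite gt_eqF.
have q0 : 0 < Num.sqrt (1 + u) by rewrite sqrtr_gt0.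
rewrite ge0_integral_normal_prob//; last by
  apply/measurable_EFinP; exact: measurable_exp_quadratic.
set s := (Num.sqrt (1 + u))^-1; set m := v / (1 + u).
have s2 : s ^+ 2 = (1 + u)^-1 by rewrite exprVn sqr_sqrtr// ltW.
have s0 : s != 0 by rewrite invr_eq0 gt_eqF.
transitivity (\int[leb]_x ((s * expR (v ^+ 2 / (2 * (1 + u))))%:E *
    (normal_pdf m s x)%:E))%E.
  apply: eq_integral => x _; rewrite -!EFinM; congr EFin.
  rewrite !normal_pdfE ?oner_eq0//.
  rewrite (@normal_peak_scale s) ?invr_gt0//.
  rewrite /normal_fun s2 subr0 expr1n.
  rewrite mulrCA -expRD -[RHS]mulrA [X in _ = _ * X]mulrCA -expRD [RHS]mulrA.
  congr (_ * expR _); rewrite /m -(mulr_natr (1 + u)^-1); field.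
  by rewrite u0'.
rewrite ge0_integralZl//.
- by rewrite integral_normal_pdf mule1.
- by apply/measurable_EFinP; exact: measurable_normal_pdf.
- by move=> x _; rewrite lee_fin normal_pdf_ge0.
- by rewrite lee_fin mulr_ge0// ?expR_ge0// invr_ge0 ltW.
Qed.

(** Integrating out [z.2] leaves a one-dimensional integral whose quadratic coefficient is the Schur
    complement [A - B ^+ 2 / (1 + C)]. *)
Lemma normal2_exp_quadratic (A B C : R) :
  0 < 1 + C -> 0 < (1 + A) * (1 + C) - B ^+ 2 ->
  (\int[N01 \x N01]_z
     (expR (- (2^-1 * (A * z.1 ^+ 2 + 2 * B * z.1 * z.2 + C * z.2 ^+ 2))))%:E =
   ((Num.sqrt ((1 + A) * (1 + C) - B ^+ 2))^-1)%:E)%E.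
Proof.
move=> C0 D0.
have C0' : 1 + C != 0 by rewrite gt_eqF.
have mq : measurable_fun setT (fun z : R * R =>
    expR (- (2^-1 * (A * z.1 ^+ 2 + 2 * B * z.1 * z.2 + C * z.2 ^+ 2)))).
  apply: measurableT_comp => //; apply: measurableT_comp => //.
  apply: measurable_funM => //; apply: measurable_funD; last first.
    by apply: measurable_funM => //; exact: measurable_funX.
  apply: measurable_funD.
    by apply: measurable_funM => //; exact: measurable_funX.
  by apply: measurable_funM => //; apply: measurable_funM.
rewrite fubini_tonelli1//=; last exact/measurable_EFinP.
rewrite /fubini_F.
transitivity (\int[N01]_x (((Num.sqrt (1 + C))^-1)%:E *
    (expR (0 * x - 2^-1 * ((A - B ^+ 2 / (1 + C)) * x ^+ 2)))%:E))%E.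
  apply: eq_integral => x _ /=.
  transitivity (\int[N01]_y ((expR (- (2^-1 * (A * x ^+ 2))))%:E *
      (expR (- (B * x) * y - 2^-1 * (C * y ^+ 2)))%:E))%E.
    apply: eq_integral => y _; rewrite -EFinM -expRD; congr (expR _)%:E.
    by field.
  rewrite ge0_integralZl//; last first.
    by apply/measurable_EFinP; exact: measurable_exp_quadratic.
  rewrite normal_exp_quadratic// -!EFinM mulrCA -expRD; congr (_ * expR _)%:E.
  by field.
rewrite ge0_integralZl//; last first.
  by apply/measurable_EFinP; exact: measurable_exp_quadratic.
have E0 : 1 + (A - B ^+ 2 / (1 + C)) = ((1 + A) * (1 + C) - B ^+ 2) / (1 + C).
  by field.
rewrite normal_exp_quadratic E0 ?divr_gt0//.
rewrite -EFinM expr0n mul0r expR0 mulr1; congr EFin.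
rewrite -invfM -sqrtrM ?ltW//; congr (Num.sqrt _)^-1.
by rewrite mulrC divfK.
Qed.

End normal_exponential_moments.

(** By monotone convergence. It bridges the gap between the uniqueness theorem, which covers bounded
    test functions, and the unbounded exponentials wanted below. *)
Lemma le_integral_truncation (R : realType) d (O : measurableType d)
    (P : probability O R) (f : O -> R) (c : \bar R) :
  measurable_fun setT f -> (forall w, 0 <= f w) ->
  (forall n : nat, (\int[P]_w (Num.min (f w) n%:R)%:E <= c)%E) ->
  (\int[P]_w (f w)%:E <= c)%E.
Proof.
move=> mf f0 fc.
have mm n : measurable_fun setT (fun w => (Num.min (f w) n%:R)%:E).
  by apply/measurable_EFinP; exact: measurable_minr.
have fE w : ((Num.min (f w) n%:R)%:E @[n --> \oo] --> (f w)%:E)%E.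
  apply: cvg_near_cst; near=> n; congr EFin; apply/min_idPl.
  by near: n; exact: nbhs_infty_ger.
have -> : (\int[P]_w (f w)%:E =
    \int[P]_w limn (fun n => (Num.min (f w) n%:R)%:E))%E.
  by apply: eq_integral => w _; apply/esym/cvg_lim => //; exact: fE.
have n0 n w : setT w -> (0 <= (Num.min (f w) n%:R)%:E)%E.
  by move=> _; rewrite lee_fin le_min f0/=.
have nd w : setT w ->
    {homo (fun n => (Num.min (f w) n%:R)%:E) : n m / (n <= m)%N >-> (n <= m)%E}.
  by move=> _ n m nm; rewrite lee_fin le_min2// ler_nat.
have H := @cvg_monotone_convergence _ _ _ P _ measurableT _ mm n0 nd.
rewrite -(cvg_lim _ H)//; apply: lime_le; last exact: nearW.
by apply/cvg_ex; eexists; exact: H.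
Unshelve. all: by end_near. Qed.

(** [C] stands for the product of the two off-diagonal kernel entries, the only form in which they
    enter the determinant. *)
Definition laplace2 (R : realType) d (O : measurableType d)
    (P : probability O R) (a b : O -> R) (A B C : R) : Prop :=
  forall s t : R, 0 <= s -> 0 <= t ->
    (\int[P]_w (expR (- (2^-1 * (s * a w + t * b w))))%:E =
     ((Num.sqrt ((1 + s * A) * (1 + t * B) - s * t * C))^-1)%:E)%E.

Section laplace2_theory.
Context {R : realType} {d : measure_display} {O : measurableType d}.
Variables (P : probability O R) (a b : O -> R) (A B C : R).
Hypotheses (ma : measurable_fun setT a) (mb : measurable_fun setT b).
Hypotheses (a_ge0 : forall w, 0 <= a w) (b_ge0 : forall w, 0 <= b w).
Hypothesis ab : laplace2 P a b A B C.

Let det_gt0 s t : 0 <= s -> 0 <= t -> 0 < (1 + s * A) * (1 + t * B) - s * t * C.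
Proof.
move=> s0 t0; have stE := ab s0 t0.
set D := (_ - _) in stE *.
suff : 0 < (Num.sqrt D)^-1 by rewrite invr_gt0 sqrtr_gt0.
rewrite lt_def invr_ge0 sqrtr_ge0 andbT; apply/eqP => D0.
rewrite D0 in stE.
have mE : measurable_fun setT
    (fun w => (expR (- (2^-1 * (s * a w + t * b w))))%:E).
  apply/measurable_EFinP; apply: measurableT_comp => //.
  apply: measurableT_comp => //; apply: measurable_funM => //.
  by apply: measurable_funD; exact: measurable_funM.
have : (\int[P]_w `|(expR (- (2^-1 * (s * a w + t * b w))))%:E| = 0)%E.
  rewrite -[RHS]stE; apply: eq_integral => w _.
  by rewrite gee0_abs// lee_fin expR_ge0.
move=> /(ae_eq_integral_abs _ measurableT mE) [N [mN PN subN]].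
have : N = setT.
  apply/seteqP; split => // w _; apply: subN => /= /(_ I) /eqP.
  by rewrite eqe gt_eqF// expR_gt0.
move=> NT; have := probability_setT P; rewrite -NT [X in X = _]PN => /eqP.
by rewrite eq_sym onee_eq0.
Qed.

Lemma laplace2_diag_ge0 : 0 <= A.
Proof.
rewrite leNgt; apply/negP => A0.
(* At [s = - A^-1] and [t = 0] the determinant would vanish. *)
have := @det_gt0 (- A^-1) 0; rewrite oppr_ge0 invr_le0 (ltW A0) lexx.
move=> /(_ isT isT).
by rewrite mulNr mulVf ?lt_eqF// subrr !mul0r mulr0 mul0r subrr ltxx.
Qed.

Lemma laplace2_diag_ge0r : 0 <= B.
Proof.
rewrite leNgt; apply/negP => B0.
have := @det_gt0 0 (- B^-1); rewrite oppr_ge0 invr_le0 (ltW B0) lexx.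
move=> /(_ isT isT).
by rewrite mulNr mulVf ?lt_eqF// subrr !mul0r mulr0 subrr ltxx.
Qed.

Lemma laplace2_offdiag_le : C <= A * B.
Proof.
rewrite leNgt; apply/negP => CAB.
have A0 := laplace2_diag_ge0; have B0 := laplace2_diag_ge0r.
pose e := C - A * B; have e0 : 0 < e by rewrite subr_gt0.
(* At [s = t] the determinant is [1 + s (A + B) - s (s e)]; this [s] makes [s e] exceed [A + B + 1],
   so that it is negative. *)
pose s := (A + B + 1) / e + 1.
have s1 : 1 <= s by rewrite lerDr divr_ge0 ?ltW//; lra.
have se : s * e = A + B + 1 + e by rewrite /s mulrDl divfK ?gt_eqF// mul1r.
have s0 : 0 <= s by lra.
have := det_gt0 s0 s0.
have -> : (1 + s * A) * (1 + s * B) - s * s * C = 1 + s * (A + B) - s * (s * e).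
  by rewrite /e; ring.
by rewrite se; nra.
Qed.

Hypothesis C_ge0 : 0 <= C.

(* A pair of squares of centred Gaussian variables with covariance matrix
   [[A, sqrt C], [sqrt C, B]] has the same Laplace transform, hence the same law. *)
Lemma laplace2_le_gauss (h : R -> R -> R) :
  continuous (fun xy : R * R => h xy.1 xy.2) -> (forall x y, 0 <= h x y) ->
  measurable_fun setT (fun w => h (a w) (b w)) ->
  exists p q r : R, [/\ p ^+ 2 = A, p * q = Num.sqrt C, q ^+ 2 + r ^+ 2 = B &
    measurable_fun setT
      (fun z : R * R => h ((p * z.1) ^+ 2) ((q * z.1 + r * z.2) ^+ 2)) ->
    (\int[P]_w (h (a w) (b w))%:E <=
     \int[normal_prob (0 : R) 1 \x normal_prob (0 : R) 1]_z
       (h ((p * z.1) ^+ 2) ((q * z.1 + r * z.2) ^+ 2))%:E)%E].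
Proof.
move=> hc h0 mh.
have A0 := laplace2_diag_ge0; have B0 := laplace2_diag_ge0r.
have CAB := laplace2_offdiag_le.
(* This is the Cholesky factor of the covariance matrix. If [A = 0] the division yields [q = 0],
   which is consistent because [C <= A * B] then forces [C = 0]. *)
pose p := Num.sqrt A; pose q := Num.sqrt C / Num.sqrt A.
have pq : p * q = Num.sqrt C.
  rewrite /q mulrCA; have [A00|A00] := eqVneq A 0; last first.
    by rewrite divff ?mulr1// gt_eqF// sqrtr_gt0 lt_def A00.
  have -> : C = 0 by apply/eqP; rewrite eq_le C_ge0 andbT (le_trans CAB)// A00 mul0r.
  by rewrite sqrtr0 mul0r.
have q2 : q ^+ 2 <= B.
  rewrite /q expr_div_n !sqr_sqrtr//.
  have [->|A00] := eqVneq A 0; first by rewrite invr0 mulr0.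
  by rewrite ler_pdivrMr 1?mulrC// lt_def A00.
pose r := Num.sqrt (B - q ^+ 2).
have p2 : p ^+ 2 = A by rewrite sqr_sqrtr.
have r2 : q ^+ 2 + r ^+ 2 = B by rewrite sqr_sqrtr ?subr_ge0// addrC subrK.
exists p, q, r; split => // mg.
apply: le_integral_truncation => // n.
have := @laplace_mean_eq R _ _ _ _ P
  (normal_prob (0 : R) 1 \x normal_prob (0 : R) 1)%E a b
  (fun z => (p * z.1) ^+ 2) (fun z => (q * z.1 + r * z.2) ^+ 2).
move=> /(_ _ _ _ _ _ _ _ _ _ (fun x y => Num.min (h x y) n%:R) n%:R) ->//.
- apply: ge0_le_integral => //.
  + by move=> z _; rewrite lee_fin le_min h0/=.
  + by apply/measurable_EFinP; exact: measurable_minr.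
  + exact/measurable_EFinP.
  + by move=> z _; rewrite lee_fin ge_min lexx.
- by apply: measurable_funX; exact: measurable_funM.
- by apply: measurable_funX; apply: measurable_funD; exact: measurable_funM.
- by move=> z; exact: sqr_ge0.
- by move=> z; exact: sqr_ge0.
- move=> i j; rewrite ab//.
  have i0 : 0 <= i%:R :> R by []. have j0 : 0 <= j%:R :> R by [].
  have := @normal2_exp_quadratic R (i%:R * p ^+ 2 + j%:R * q ^+ 2)
    (j%:R * q * r) (j%:R * r ^+ 2).
  have D : (1 + (i%:R * p ^+ 2 + j%:R * q ^+ 2)) * (1 + j%:R * r ^+ 2) -
     (j%:R * q * r) ^+ 2 = (1 + i%:R * A) * (1 + j%:R * B) - i%:R * j%:R * C.
    by rewrite -p2 -r2 -(sqr_sqrtr C_ge0) -pq; ring.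
  rewrite D => E; rewrite -E.
  + by apply: eq_integral => z _; congr (expR (- _))%:E; ring.
  + by rewrite ltr_pwDl// mulr_ge0// sqr_ge0.
  + exact: det_gt0.
- move=> x y; rewrite ger0_norm ?le_min ?h0//= ge_min lexx orbT//.
- move=> z; apply: (@continuous_min _ _ (fun xy : R * R => h xy.1 xy.2)
    (cst n%:R) z); [exact: hc|exact: cst_continuous].
Qed.

(** In the Gaussian model the square roots are absolute values, and the reverse triangle inequality
    bounds their difference by that of the Gaussian variables, whose variance is
    [A + B - 2 * Num.sqrt C]. *)
Lemma laplace2_sqrt_increment (l : R) : 0 <= l ->
  2 * l * (A + B - 2 * Num.sqrt C) < 1 ->
  (\int[P]_w (expR (l * (Num.sqrt (a w) - Num.sqrt (b w)) ^+ 2))%:E <=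
   ((Num.sqrt (1 - 2 * l * (A + B - 2 * Num.sqrt C)))^-1)%:E)%E.
Proof.
move=> l0 ls1.
have msqrt d' (T' : measurableType d') (f : T' -> R) : measurable_fun setT f ->
    measurable_fun setT (fun x => Num.sqrt (f x)).
  by move=> mf; apply: (measurableT_comp _ mf); apply: continuous_measurable_fun;
     exact: sqrt_continuous.
have mincr d' (T' : measurableType d') (f g : T' -> R) :
    measurable_fun setT f -> measurable_fun setT g ->
    measurable_fun setT (fun x => expR (l * (Num.sqrt (f x) - Num.sqrt (g x)) ^+ 2)).
  move=> mf mg; apply: measurableT_comp => //; apply: measurable_funM => //.
  by apply: measurable_funX; apply: measurable_funB; exact: msqrt.
have [] := @laplace2_le_gauss
  (fun x y => expR (l * (Num.sqrt x - Num.sqrt y) ^+ 2)).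
- have cd : continuous (fun xy : R * R => Num.sqrt xy.1 - Num.sqrt xy.2).
    by move=> z; apply: cvgB; apply: continuous_comp;
      [exact: cvg_fst|exact: sqrt_continuous|exact: cvg_snd|exact: sqrt_continuous].
  move=> z; apply: continuous_comp; last exact: continuous_expR.
  by apply: cvgM; [exact: cvg_cst|apply: cvgM; exact: cd].
- by move=> x y; exact: expR_ge0.
- exact: mincr.
move=> p [q [r [p2 pq qr]]] /(_ _) H.
have s2 : A + B - 2 * Num.sqrt C = (p - q) ^+ 2 + r ^+ 2.
  by rewrite -p2 -qr -pq; ring.
have mp : measurable_fun setT (fun z : R * R => p * z.1).
  exact: measurable_funM.
have mqr : measurable_fun setT (fun z : R * R => q * z.1 + r * z.2).
  by apply: measurable_funD; exact: measurable_funM.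
have mpq : measurable_fun setT (fun z : R * R => expR (l *
    (Num.sqrt ((p * z.1) ^+ 2) - Num.sqrt ((q * z.1 + r * z.2) ^+ 2)) ^+ 2)).
  by apply: mincr; exact: measurable_funX.
apply: (le_trans (H mpq)).
have C0 : 0 < 1 + - (2 * l * r ^+ 2).
  rewrite subr_gt0; move: ls1; rewrite s2 mulrDr; apply: le_lt_trans.
  by rewrite lerDr mulr_ge0 ?sqr_ge0// mulr_ge0.
have := @normal2_exp_quadratic R (- (2 * l * (p - q) ^+ 2)) (2 * l * (p - q) * r)
  (- (2 * l * r ^+ 2)).
have -> : (1 + - (2 * l * (p - q) ^+ 2)) * (1 + - (2 * l * r ^+ 2)) -
    (2 * l * (p - q) * r) ^+ 2 = 1 - 2 * l * (A + B - 2 * Num.sqrt C).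
  by rewrite s2; ring.
move=> <-//; last by rewrite subr_gt0.
apply: ge0_le_integral => //.
- exact/measurable_EFinP.
- apply/measurable_EFinP; apply: measurableT_comp => //.
  apply: measurableT_comp => //; apply: measurable_funM => //.
  apply: measurable_funD; last first.
    by apply: measurable_funM => //; exact: measurable_funX.
  apply: measurable_funD.
    by apply: measurable_funM => //; exact: measurable_funX.
  by apply: measurable_funM => //; exact: measurable_funM.
- move=> z _; rewrite lee_fin ler_expR !sqrtr_sqr.
  rewrite [leRHS](_ : _ = l * (p * z.1 - (q * z.1 + r * z.2)) ^+ 2); last by field.
  rewrite ler_wpM2l// -(real_normK (num_real (_ - _)))
    -[leRHS](real_normK (num_real (_ - _))).
  by rewrite lerXn2r ?nnegrE//; exact: ler_dist_dist.
Qed.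

Lemma laplace2_exp (l : R) : 0 <= l -> 2 * l * A < 1 ->
  (\int[P]_w (expR (l * a w))%:E <= ((Num.sqrt (1 - 2 * l * A))^-1)%:E)%E.
Proof.
move=> l0 lA.
have [] := @laplace2_le_gauss (fun x y => expR (l * x)).
- move=> z; apply: continuous_comp; last exact: continuous_expR.
  by apply: cvgM; [exact: cvg_cst|exact: cvg_fst].
- by move=> x y; exact: expR_ge0.
- by apply: measurableT_comp => //; exact: measurable_funM.
move=> p [q [r [p2 _ _]]] /(_ _) H.
have mp : measurable_fun setT (fun z : R * R => expR (l * (p * z.1) ^+ 2)).
  apply: measurableT_comp => //; apply: measurable_funM => //.
  by apply: measurable_funX; exact: measurable_funM.
apply: (le_trans (H mp)).
have := @normal2_exp_quadratic R (- (2 * l * A)) 0 0.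
rewrite addr0 mulr1 expr0n subr0 ltr01 subr_gt0 => <-//.
rewrite le_eqVlt; apply/orP; left; apply/eqP; apply: eq_integral => z _.
by congr (expR _)%:E; rewrite -p2; field.
Qed.

End laplace2_theory.

(** * Increments of the square root of a permanental process *)

Section permanental_increments.
Context {R : realType} {dO : measure_display} {Omega : measurableType dO}.
Variables (P : probability Omega R) (T : Type) (Gamma : T -> T -> R).
Variable theta : T -> {RV P >-> R}.
Hypothesis perm : permanental_process Gamma theta.

Let theta_ge0 x w : 0 <= theta x w.
Proof. by case: perm. Qed.

Lemma permanental_laplace2 x y : laplace2 P (theta x) (theta y)
  (Gamma x x) (Gamma y y) (Gamma x y * Gamma y x).
Proof.
move=> s t s0 t0; have [_ H] := perm.
pose f (i : 'I_2) : T := if i == 0 then x else y.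
pose al : 'rV[R]_2 := \row_i (if i == 0 then s else t).
have al0 i : 0 <= al 0 i by rewrite mxE; case: ifP.
have := H 2%N f al al0.
rewrite unlock; under eq_integral => w _ do
  rewrite big_ord_recl big_ord1 !mxE /=.
move=> ->; congr ((Num.sqrt _)^-1)%:E.
rewrite (expand_det_row _ ord0) !big_ord_recl big_ord0 /cofactor !det_mx11.
rewrite !mxE !big_ord_recl !big_ord0 !mxE /=.
by rewrite /f /=; ring.
Qed.

(** The pair [(x, x)] has off-diagonal product [Gamma x x ^+ 2], which is nonnegative, so the
    Gaussian comparison applies to each marginal law. *)
Lemma permanental_exp_half (x : T) (l : R) : 0 <= l -> 2 * l * Gamma x x < 1 ->
  (\int[P]_w (expR (l * theta x w))%:E <=
   ((Num.sqrt (1 - 2 * l * Gamma x x))^-1)%:E)%E.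
Proof.
move=> l0; apply: (laplace2_exp _ _ _ _ (permanental_laplace2 x x)) => //.
by rewrite -expr2 sqr_ge0.
Qed.

(** The constant in [kernel_dist] is made for this bound. Its square is 32/3 times the Gaussian
    variance, so [kernel_dist <= 2 c] bounds the variance by [3/8 c^2]; with [l = c ^- 2] the
    exponential moment is at most [(1 - 3/4)^(-1/2) = 2]. *)
Lemma permanental_sqrt_increment x y (c : R) :
  0 < c -> kernel_dist Gamma x y <= 2 * c ->
  (\int[P]_w (expR (((Num.sqrt (theta x w) - Num.sqrt (theta y w)) / c) ^+ 2))%:E
     <= 2%:E)%E.
Proof.
move=> c0 dc.
have L := permanental_laplace2 x y.
have mx z : measurable_fun setT (theta z) by [].
have A0 := laplace2_diag_ge0 (mx x) (mx y) L.
have B0 := laplace2_diag_ge0r (mx x) (mx y) L.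
have CAB := laplace2_offdiag_le (mx x) (mx y) L.
set A := Gamma x x in L A0 CAB *; set B := Gamma y y in L B0 CAB *.
set C := Gamma x y * Gamma y x in L CAB *.
have s_ge0 : 0 <= A + B - 2 * Num.sqrt C.
  have : Num.sqrt C <= Num.sqrt A * Num.sqrt B by rewrite -sqrtrM// ler_wsqrtr.
  have := sqr_ge0 (Num.sqrt A - Num.sqrt B).
  by rewrite sqrrB !sqr_sqrtr// -mulr_natr; lra.
pose l := c ^- 2.
have l0 : 0 <= l by rewrite invr_ge0 exprn_ge0// ltW.
have ls : 2 * l * (A + B - 2 * Num.sqrt C) <= 3 / 4.
  suff : A + B - 2 * Num.sqrt C <= 3 / 8 * c ^+ 2.
    move=> h; have := ler_wpM2l l0 h.
    have : l * c ^+ 2 = 1 by rewrite mulVf// expf_neq0// gt_eqF.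
    by lra.
  have : kernel_dist Gamma x y ^+ 2 <= (2 * c) ^+ 2.
    by rewrite lerXn2r ?nnegrE ?mulr_ge0 ?sqrtr_ge0// ltW.
  have s23 : Num.sqrt (2 / 3) ^+ 2 = 2 / 3 :> R by rewrite sqr_sqrtr//; lra.
  by rewrite /kernel_dist -/A -/B -/C !exprMn s23 (sqr_sqrtr s_ge0); lra.
have expE w : expR (((Num.sqrt (theta x w) - Num.sqrt (theta y w)) / c) ^+ 2) =
    expR (l * (Num.sqrt (theta x w) - Num.sqrt (theta y w)) ^+ 2).
  by rewrite exprMn exprVn mulrC.
under eq_integral do rewrite expE.
have half (u : R) : u <= 3 / 4 -> (Num.sqrt (1 - u))^-1 <= 2.
  move=> u34; rewrite -[leRHS]invrK lef_pV2 ?posrE ?sqrtr_gt0; [|lra|lra].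
  rewrite -[leLHS]ger0_norm; last lra.
  by rewrite -sqrtr_sqr ler_wsqrtr; lra.
have [C0|C0] := leP 0 C.
  apply: le_trans (laplace2_sqrt_increment _ _ _ _ L _ _ _) _ => //; first lra.
  by rewrite lee_fin half.
move: ls; rewrite (ler0_sqrtr (ltW C0)) mulr0 subr0 => ls.
(* By convexity, [(1 - u)^(-1/2)] lies below its chord from [(0, 1)] to [(3/4, 2)]. Adding this
   bound for both marginals and subtracting [1] gives [2] again, as the two arguments sum to at most
   [3/4]. *)
have chord (u : R) : 0 <= u <= 3 / 4 -> (Num.sqrt (1 - u))^-1 <= 1 + 4 / 3 * u.
  move=> /andP[u0 u1]; have s0 : 0 < Num.sqrt (1 - u) by rewrite sqrtr_gt0; lra.
  have k0 : 0 < 1 + 4 / 3 * u by lra.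
  rewrite -[leRHS]invrK lef_pV2 ?posrE ?invr_gt0//.
  have i0 : 0 <= (1 + 4 / 3 * u)^-1 by rewrite invr_ge0 ltW.
  rewrite -(ger0_norm i0) -sqrtr_sqr ler_wsqrtr//.
  rewrite exprVn -div1r ler_pdivrMr ?exprn_gt0//.
  suff : 0 <= u * (5 / 3 - 8 / 9 * u - 16 / 9 * u ^+ 2) by lra.
  by rewrite mulr_ge0//; nra.
have lA : 0 <= 2 * l * A by rewrite !mulr_ge0.
have lB : 0 <= 2 * l * B by rewrite !mulr_ge0.
have lAB : 2 * l * A + 2 * l * B <= 3 / 4 by rewrite -mulrDr.
have ex := permanental_exp_half (x := x) l0; have ey := permanental_exp_half (x := y) l0.
rewrite -/A in ex; rewrite -/B in ey.
have mexp z : measurable_fun setT (fun w => (expR (l * theta z w))%:E).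
  by apply/measurable_EFinP; apply: measurableT_comp => //; exact: measurable_funM.
have msqrt z : measurable_fun setT (fun w => Num.sqrt (theta z w)).
  apply: (measurableT_comp _ (mx z)); apply: continuous_measurable_fun.
  exact: sqrt_continuous.
(* Only the marginal laws are known to be those of squared Gaussian variables
   here, but [max (e^(l a), e^(l b)) <= e^(l a) + e^(l b) - 1] suffices. *)
have : (\int[P]_w (expR (l * (Num.sqrt (theta x w) - Num.sqrt (theta y w)) ^+ 2) + 1)%:E
   <= \int[P]_w ((expR (l * theta x w))%:E + (expR (l * theta y w))%:E))%E.
  apply: ge0_le_integral => //.
  - apply/measurable_EFinP; apply: measurable_funD => //.
    apply: measurableT_comp => //; apply: measurable_funM => //.
    by apply: measurable_funX; exact: measurable_funB.
  - exact: emeasurable_funD.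
  - move=> w _; rewrite -EFinD lee_fin.
    have e1 z : 1 <= expR (l * theta z w) by rewrite -expR0 ler_expR mulr_ge0.
    have [xy|xy] := leP (theta x w) (theta y w).
      suff : expR (l * (Num.sqrt (theta x w) - Num.sqrt (theta y w)) ^+ 2) <=
        expR (l * theta y w) by have := e1 x; lra.
      rewrite ler_expR ler_wpM2l// -[leRHS](sqr_sqrtr (theta_ge0 y w)).
      have := ler_wsqrtr xy; have := sqrtr_ge0 (theta x w); nra.
    suff : expR (l * (Num.sqrt (theta x w) - Num.sqrt (theta y w)) ^+ 2) <=
      expR (l * theta x w) by have := e1 y; lra.
    rewrite ler_expR ler_wpM2l// -[leRHS](sqr_sqrtr (theta_ge0 x w)).
    have := ler_wsqrtr (ltW xy); have := sqrtr_ge0 (theta y w); nra.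
rewrite [X in (_ <= X)%E]ge0_integralD// => sum_le.
rewrite -(@leeD2rE _ 1%:E)//.
have -> : (\int[P]_w (expR (l * (Num.sqrt (theta x w) - Num.sqrt (theta y w)) ^+ 2))%:E
    + 1%:E = \int[P]_w (expR (l * (Num.sqrt (theta x w) - Num.sqrt (theta y w)) ^+ 2)
    + 1)%:E)%E.
  under [RHS]eq_integral do rewrite EFinD.
  rewrite ge0_integralD//.
    by rewrite integral_cst//= probability_setT mule1.
  apply/measurable_EFinP; apply: measurableT_comp => //.
  apply: measurable_funM => //.
  by apply: measurable_funX; exact: measurable_funB.
apply: (le_trans sum_le); apply: (le_trans (leeD (ex _) (ey _))).
- by lra.
- by lra.
- rewrite -!EFinD lee_fin.
  have h1 : (Num.sqrt (1 - 2 * l * A))^-1 <= 1 + 4 / 3 * (2 * l * A).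
    by apply: chord; lra.
  have h2 : (Num.sqrt (1 - 2 * l * B))^-1 <= 1 + 4 / 3 * (2 * l * B).
    by apply: chord; lra.
  lra.
Qed.

End permanental_increments.

(** * Chaining *)

Section finite_chaining.
Variables (R : realType) (I : finType) (nu X : I -> R) (rho : I -> I -> R).
Variables (K Z : R).
Hypotheses (nu_ge0 : forall i, 0 <= nu i) (nu_sum : \sum_i nu i <= 1).
Hypotheses (rho_ge0 : forall i j, 0 <= rho i j) (rhoxx : forall i, rho i i = 0).
Hypotheses (rhoC : forall i j, rho i j = rho j i).
Hypothesis rhoD : forall i j k, rho i k <= rho i j + rho j k.
Hypothesis X_eq : forall i j, rho i j = 0 -> X i = X j.
Hypotheses (K_gt0 : 0 < K) (Z_gt1 : 1 < Z).
Hypothesis Z_ge : \sum_i \sum_j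
  nu i * nu j * expR (((X i - X j) / (K * rho i j)) ^+ 2) <= Z.

Definition ball_mass (s : I) (r : R) := \sum_(i | rho i s <= r) nu i.
Let avg (s : I) (r : R) :=
  (\sum_(i | rho i s <= r) nu i * X i) / ball_mass s r.
Let F (s : I) (r : R) := Num.sqrt (ln (ball_mass s r)^-1).

Let ball_mass_le1 s r : ball_mass s r <= 1.
Proof.
apply: le_trans nu_sum; rewrite [leRHS](bigID (fun i => rho i s <= r))/=.
by rewrite lerDl sumr_ge0.
Qed.

Let sqrt_lnV_ge0 (m : R) : 0 < m <= 1 -> 0 <= ln m^-1.
Proof. by move=> /andP[m0 m1]; rewrite ln_ge0// invf_ge1. Qed.

Let sqrt_subadd (x y : R) : 0 <= x -> 0 <= y ->
  Num.sqrt (x + y) <= Num.sqrt x + Num.sqrt y.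
Proof.
move=> x0 y0; rewrite -[leRHS]ger0_norm ?addr_ge0 ?sqrtr_ge0//.
rewrite -sqrtr_sqr ler_wsqrtr// sqrrD !sqr_sqrtr// -mulr_natr.
have := mulr_ge0 (sqrtr_ge0 x) (sqrtr_ge0 y); lra.
Qed.

(* Jensen's inequality for [x |-> exp (x^2)], in the form of the tangent
   inequality [exp (y^2) >= exp (L^2) (1 + 2 L (y - L))]. *)
Let avg_sub s t r r' : 0 <= r -> 0 <= r' -> 0 < rho s t + r + r' ->
  0 < ball_mass s r -> 0 < ball_mass t r' ->
  avg s r - avg t r' <= K * (rho s t + r + r') *
    (Num.sqrt (ln Z) + F s r + F t r').
Proof.
move=> r0 r'0 D0 Ns Nt.
set Dl := K * (rho s t + r + r'); have Dl0 : 0 < Dl by rewrite mulr_gt0.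
set N := ball_mass s r in Ns *; set N' := ball_mass t r' in Nt *.
have N1 : N <= 1 by exact: ball_mass_le1.
have N'1 : N' <= 1 by exact: ball_mass_le1.
have NN0 : 0 < N * N' by rewrite mulr_gt0.
have lnZ : 0 < ln Z by rewrite ln_gt0.
have lN : 0 <= ln N^-1 by apply: sqrt_lnV_ge0; rewrite Ns.
have lN' : 0 <= ln N'^-1 by apply: sqrt_lnV_ge0; rewrite Nt.
(* Chosen so that [expR Q * (N * N') = Z]: after summing the tangent inequality over both balls, [Z]
   cancels and the difference of averages is at most [Dl * L] with [L ^+ 2 = Q]. *)
pose Q := ln Z + ln N^-1 + ln N'^-1.
have Q0 : 0 < Q by rewrite /Q; lra.
have eQ : expR Q = Z / (N * N').
  by rewrite /Q !expRD !lnK ?posrE ?invr_gt0// ?(lt_trans ltr01)// invfM mulrA.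
pose L := Num.sqrt Q; have L0 : 0 < L by rewrite sqrtr_gt0.
have L2 : L ^+ 2 = Q by rewrite sqr_sqrtr// ltW.
have LF : L <= Num.sqrt (ln Z) + F s r + F t r'.
  apply: le_trans (sqrt_subadd _ lN') _; first by rewrite addr_ge0// ltW.
  by rewrite lerD2r; apply: sqrt_subadd => //; exact: ltW.
apply: (@le_trans _ _ (Dl * L)); last by rewrite ler_pM2l.
have pt i j : rho i s <= r -> rho j t <= r' ->
    expR Q * (1 + 2 * L * ((X i - X j) / Dl - L)) <=
    expR (((X i - X j) / (K * rho i j)) ^+ 2).
  move=> is_ jt; apply: (@le_trans _ _ (expR (((X i - X j) / Dl) ^+ 2))).
    set y := (X i - X j) / Dl.
    rewrite [leRHS](_ : _ = expR Q * expR (y ^+ 2 - Q)); last first.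
      by rewrite -expRD; congr expR; ring.
    rewrite ler_wpM2l ?expR_ge0//; apply: le_trans (expR_ge1Dx _).
    by rewrite -L2; have := sqr_ge0 (y - L); rewrite sqrrB -mulr_natr; lra.
  rewrite ler_expR !expr_div_n.
  have [r00|r00] := eqVneq (rho i j) 0.
    by rewrite (X_eq r00) subrr expr0n !mul0r.
  have rij : 0 < rho i j by rewrite lt_def r00 rho_ge0.
  rewrite ler_wpM2l ?sqr_ge0// lef_pV2 ?posrE ?exprn_gt0 ?mulr_gt0//.
  have K_ge0 := ltW K_gt0; have Dl_ge0 := ltW Dl0.
  apply: lerXn2r; [by rewrite nnegrE mulr_ge0|by rewrite nnegrE|].
  rewrite /Dl ler_pM2l//.
  by have := rhoD i s j; have := rhoD s t j; rewrite (rhoC t j); lra.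
have Zge : expR Q * \sum_(i | rho i s <= r) \sum_(j | rho j t <= r')
    nu i * nu j * (1 + 2 * L * ((X i - X j) / Dl - L)) <= Z.
  apply: le_trans Z_ge; rewrite mulr_sumr.
  apply: (@le_trans _ _ (\sum_(i | rho i s <= r) \sum_j
     nu i * nu j * expR (((X i - X j) / (K * rho i j)) ^+ 2))).
    apply: ler_sum => i is_; rewrite mulr_sumr.
    rewrite [leRHS](bigID (fun j => rho j t <= r'))/= -[leLHS]addr0 lerD//.
      apply: ler_sum => j jt; rewrite mulrCA ler_wpM2l ?mulr_ge0//.
      exact: pt.
    by apply: sumr_ge0 => j _; rewrite !mulr_ge0// expR_ge0.
  rewrite [leRHS](bigID (fun i => rho i s <= r))/= lerDl.
  by apply: sumr_ge0 => i _; apply: sumr_ge0 => j _; rewrite !mulr_ge0// expR_ge0.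
have dsum : \sum_(i | rho i s <= r) \sum_(j | rho j t <= r')
    nu i * nu j * (1 + 2 * L * ((X i - X j) / Dl - L)) =
    N * N' * (1 - 2 * Q + 2 * L / Dl * (avg s r - avg t r')).
  have eN : \sum_(i | rho i s <= r) nu i * X i = N * avg s r.
    by rewrite /avg mulrC divfK// gt_eqF.
  have eN' : \sum_(i | rho i t <= r') nu i * X i = N' * avg t r'.
    by rewrite /avg mulrC divfK// gt_eqF.
  have eM : \sum_(i | rho i s <= r) nu i = N by [].
  have eM' : \sum_(i | rho i t <= r') nu i = N' by [].
  transitivity (\sum_(i | rho i s <= r)
     (nu i * (N' * (1 - 2 * Q)) + 2 * L / Dl * (nu i * X i * N') -
      2 * L / Dl * (nu i * (N' * avg t r')))).
    apply: eq_bigr => i _.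
    transitivity (\sum_(j | rho j t <= r') (nu i * (1 - 2 * Q) * nu j +
        2 * L / Dl * (nu i * X i) * nu j - 2 * L / Dl * nu i * (nu j * X j))).
      by apply: eq_bigr => j _; rewrite -L2; field; rewrite gt_eqF.
    by rewrite sumrB big_split/= -!mulr_sumr eN' eM'; ring.
  rewrite sumrB big_split/= -!mulr_suml -!mulr_sumr -!mulr_suml eN eM; ring.
move: Zge; rewrite dsum eQ mulrA divfK ?gt_eqF// ger_pMr ?(lt_trans ltr01)//.
move=> h; have : 2 * L * ((avg s r - avg t r') / Dl - L) <= 0.
  rewrite [leLHS](_ : _ = 2 * L / Dl * (avg s r - avg t r') - 2 * Q); last first.
    by rewrite -L2; ring.
  by lra.
by rewrite pmulr_rle0 ?mulr_gt0// subr_le0 ler_pdivrMr// mulrC.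
Qed.

Let avg_dist s t r r' : 0 <= r -> 0 <= r' -> 0 < rho s t + r + r' ->
  0 < ball_mass s r -> 0 < ball_mass t r' ->
  `|avg s r - avg t r'| <= K * (rho s t + r + r') *
    (Num.sqrt (ln Z) + F s r + F t r').
Proof.
move=> r0 r'0 D0 Ns Nt; rewrite ler_norml; apply/andP; split; last exact: avg_sub.
have := @avg_sub t s r' r r'0 r0; rewrite rhoC addrAC => /(_ D0 Nt Ns).
by rewrite [X in _ * X]addrAC; lra.
Qed.

Let radius (b : R) k := b / 2 ^+ k.

Let radius_gt0 b k : 0 < b -> 0 < radius b k.
Proof. by move=> b0; rewrite divr_gt0// exprn_gt0. Qed.

Let radiusS b k : radius b k.+1 = radius b k / 2.
Proof. by rewrite /radius exprSr invfM mulrA. Qed.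

(** Telescoping over the radii [b / 2^k]. A step has total radius [3/2 r_k = 3 (r_k - r_(k+1))], and
    [F] at an interior radius collects [3/2 r_k] from one side and [3 r_k] from the other, hence
    [9/2]. The subtracted terms correct the two end radii and make the induction step an
    equality. *)
Let chain s b n : 0 < b -> (forall k, 0 < ball_mass s (radius b k)) ->
  `|avg s b - avg s (radius b n)| <=
  K * (3 * (b - radius b n) * Num.sqrt (ln Z) +
       9 / 2 * \sum_(k < n.+1) radius b k * F s (radius b k)
       - 3 * b * F s b - 3 / 2 * radius b n * F s (radius b n)).
Proof.
move=> b0 N0; elim: n => [|n IH].
  rewrite big_ord_recl big_ord0 /radius expr0 divr1 !subrr normr0 mulr0 mul0r.
  by rewrite mulr_ge0 ?(ltW K_gt0)//; lra.
rewrite -[avg s b](subrK (avg s (radius b n))) -addrA.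
apply: le_trans (ler_normD _ _) _.
have rn0 := radius_gt0 n b0; have rn1 := radius_gt0 n.+1 b0.
have := @avg_dist s s (radius b n) (radius b n.+1) (ltW rn0) (ltW rn1).
rewrite rhoxx add0r => /(_ (addr_gt0 rn0 rn1) (N0 _) (N0 _)) h.
apply: le_trans (lerD IH h) _.
rewrite [in leRHS]big_ord_recr/=; set S := \sum_(k < n.+1) _.
rewrite le_eqVlt; apply/orP; left; apply/eqP.
by rewrite radiusS; field.
Qed.

(** Pass from [X s] to its average at radius [b], to that of [t], then to [X t]. The [ln Z] terms
    add up to [3 + 4 + 3 = 10]. The endpoints give [9 + 9] times [J]; what is left of the [F] terms,
    [b (F s b + F t b)], is at most [4 J], hence [22]. *)
Lemma finite_chaining s t b J : 0 < b -> rho s t <= 2 * b ->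
  (forall u r, 0 < r -> 0 < ball_mass u r) ->
  (forall u n, \sum_(k < n) b / 2 ^+ k *
     Num.sqrt (ln (ball_mass u (b / 2 ^+ k))^-1) <= 2 * J) ->
  `|X s - X t| <= K * (22 * J + 10 * b * Num.sqrt (ln Z)).
Proof.
move=> b0 st N0 SJ.
have F0 u r : 0 <= F u r by exact: sqrtr_ge0.
have lnZ0 : 0 <= Num.sqrt (ln Z) by exact: sqrtr_ge0.
have endpoint u : `|X u - avg u b| <=
    K * (3 * b * Num.sqrt (ln Z) + 9 * J - 3 * b * F u b).
  (* By finiteness, a small enough ball around [u] contains only points at distance zero, where [X]
     agrees with [X u]; the chain therefore ends exactly at [X u]. *)
  have [e e0 eX] : exists2 e, 0 < e & forall i, rho i u <= e -> rho i u = 0.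
    have : forall l : seq I, exists2 e, 0 < e &
        forall i, i \in l -> rho i u <= e -> rho i u = 0.
      elim => [|i l [e e0 el]]; first by exists 1.
      have [r0|r0] := eqVneq (rho i u) 0.
        by exists e => // j; rewrite inE => /orP[/eqP ->//|/el].
      have ri : 0 < rho i u by rewrite lt_def r0 rho_ge0.
      exists (Num.min e (rho i u / 2)); first by rewrite lt_min e0 divr_gt0.
      move=> j; rewrite inE le_min => /orP[/eqP -> /andP[_]|jl /andP[je _]].
        by lra.
      exact: el.
    by move=> /(_ (enum I)) [e e0 el]; exists e => // i; apply: el; rewrite mem_enum.
  have [n bn] : exists n, radius b n <= e.
    have [n ] : exists n, b / e <= n%:R.
      exists (Num.bound (b / e)); apply: ltW; apply: archi_boundP.
      by rewrite divr_ge0// ltW.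
    move=> bn; exists n; rewrite /radius ler_pdivrMr ?exprn_gt0// mulrC.
    rewrite -ler_pdivrMr//; apply: (le_trans bn).
    by rewrite -natrX ler_nat ltnW// ltn_expl.
  have rn0 := radius_gt0 n b0.
  have -> : X u = avg u (radius b n).
    rewrite /avg (eq_bigr (fun i => nu i * X u)); last first.
      by move=> i iu; congr (_ * _); apply: X_eq; apply: eX; exact: le_trans bn.
    by rewrite -mulr_suml mulrAC divff ?mul1r// gt_eqF// N0.
  rewrite distrC; apply: le_trans (chain n b0 _) _.
    by move=> k; apply: N0; exact: radius_gt0.
  rewrite ler_pM2l//.
  have : \sum_(k < n.+1) radius b k * F u (radius b k) <= 2 * J := SJ u n.+1.
  have := mulr_ge0 (ltW rn0) (F0 u (radius b n)).
  have := mulr_ge0 (ltW rn0) lnZ0.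
  lra.
have bF u : b * F u b <= 2 * J.
  by have := SJ u 1%N; rewrite big_ord_recl big_ord0 expr0 divr1 addr0.
have bridge : `|avg s b - avg t b| <= K * (4 * b) *
    (Num.sqrt (ln Z) + F s b + F t b).
  apply: le_trans (avg_dist (ltW b0) (ltW b0) _ (N0 _ _ b0) (N0 _ _ b0)) _.
    by have := rho_ge0 s t; lra.
  rewrite ler_wpM2r ?addr_ge0// ler_pM2l//; lra.
have -> : X s - X t = (X s - avg s b) + (avg s b - avg t b) + (avg t b - X t).
  by ring.
apply: le_trans (ler_normD _ _) _.
apply: le_trans (lerD (ler_normD _ _) (lexx _)) _.
have := endpoint s; have := endpoint t; rewrite (distrC (X t)) => ht hs.
apply: le_trans (lerD (lerD hs bridge) ht) _.
rewrite -[K * (4 * b) * _]mulrA -!mulrDr ler_pM2l//.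
have := bF s; have := bF t; lra.
Qed.

End finite_chaining.

(** * Entropy integrals and masses of balls *)

Section entropy_integral.
Context {R : realType}.

Lemma nonincreasing_emeasurable (f : R -> \bar R) :
  (forall x y, x <= y -> (f y <= f x)%E) -> measurable_fun setT f.
Proof.
move=> fni _; apply: (measurability _ (ErealGenOInfty.measurableE R)) => // _ [_ [x ->] <-].
rewrite setTI; apply: is_interval_measurable => a b /=.
rewrite !in_itv/= !andbT => _ fb c /andP[_ cb].
by rewrite in_itv/= andbT (lt_le_trans fb)// fni.
Qed.

Variables (T : ptopologicalType) (d : T -> T -> R).
Variable mu : probability (borelType T) R.
Hypothesis mB : forall t u, measurable (dball d t u : set (borelType T)).

Let mass t u : R := fine (mu (dball d t u)).
Let G t u : \bar R := sqrte (lne (mu (dball d t u))^-1).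

Let massE t u : mu (dball d t u) = (mass t u)%:E.
Proof. by rewrite fineK// fin_num_measure. Qed.

Let mass_ge0 t u : 0 <= mass t u.
Proof. by rewrite fine_ge0. Qed.

Let GE t u : 0 < mass t u -> G t u = (Num.sqrt (ln (mass t u)^-1))%:E.
Proof.
by move=> m0; rewrite /G massE inver gt_eqF// lne_EFin ?invr_gt0.
Qed.

Let Gy t u : mass t u = 0 -> G t u = +oo%E.
Proof. by move=> m0; rewrite /G massE m0 inve0. Qed.

Let G_ge0 t u : (0 <= G t u)%E.
Proof. exact: sqrte_ge0. Qed.

Lemma le_dball_mass t u v : u <= v -> mass t u <= mass t v.
Proof.
move=> uv; rewrite -lee_fin -!massE le_measure ?inE//.
by move=> s /=; rewrite /dball/= => /le_trans; apply.
Qed.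

Let G_nonincreasing t u v : u <= v -> (G t v <= G t u)%E.
Proof.
move=> uv; have [m0|m0] := ltP 0 (mass t u); last first.
  by rewrite (@Gy t u) ?leey//; apply/eqP; rewrite eq_le m0 mass_ge0.
have mv : 0 < mass t v by rewrite (lt_le_trans m0)// le_dball_mass.
rewrite !GE// lee_fin ler_wsqrtr// ler_ln ?posrE ?invr_gt0//.
by rewrite lef_pV2 ?posrE// le_dball_mass.
Qed.

Let mG t D : measurable_fun D (G t).
Proof.
apply: measurable_funTS; apply: nonincreasing_emeasurable => u v.
exact: G_nonincreasing.
Qed.

Let int_G t b : \bar R := (\int[lebesgue_measure]_(u in `[0%R, b]) G t u)%E.

Let le_int_G_J t b : (int_G t b <= J d mu b)%E.
Proof. by apply: ereal_sup_ubound; exists t. Qed.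

Let int_G_const t b : 0 <= b -> (b%:E * G t b <= int_G t b)%E.
Proof.
move=> b0; apply: (@le_trans _ _
    (\int[lebesgue_measure]_(u in `[0%R, b]) cst (G t b) u)%E).
  rewrite integral_cst//= lebesgue_measure_itv/= lte_fin muleC.
  have [b00|b00] := ltP 0 b; first by rewrite oppr0 adde0.
  by have -> : b = 0 by [apply/eqP; rewrite eq_le b0 b00]; rewrite !mule0.
apply: ge0_le_integral => //=; first exact: mG.
by move=> u; rewrite in_itv/= => /andP[_ ub]; exact: G_nonincreasing.
Qed.

Let int_G_half t b : 0 < b ->
  (int_G t (b / 2) + (b / 2)%:E * G t b <= int_G t b)%E.
Proof.
move=> b0; have b2 : b / 2 < b by lra.
have -> : int_G t b =
    (int_G t (b / 2) + \int[lebesgue_measure]_(u in `](b / 2)%R, b]) G t u)%E.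
  rewrite /int_G -ge0_integral_setU//=.
  - congr (integral _ _ _); apply/seteqP; split => u /=; rewrite !in_itv/=.
      move=> /andP[u0 ub]; have [ub2|ub2] := leP u (b / 2); [left|right].
        by rewrite u0.
      by rewrite ub.
    by move=> [] /andP[h1 h2]; apply/andP; split; lra.
  - exact: mG.
  - apply/disj_set2P/seteqP; split => u //= []; rewrite !in_itv/=.
    by move=> /andP[_ h1] /andP[h2 _]; lra.
apply: leeD => //; apply: (@le_trans _ _
    (\int[lebesgue_measure]_(u in `](b / 2)%R, b]) cst (G t b) u)%E).
  rewrite integral_cst//= lebesgue_measure_itv/= lte_fin b2 muleC -EFinB.
  by rewrite lee_wpmul2l// lee_fin; lra.
apply: ge0_le_integral => //=; first exact: mG.
by move=> u; rewrite in_itv/= => /andP[_ ub]; exact: G_nonincreasing.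
Qed.

(** On the block from [b / 2^(k+1)] to [b / 2^k], of length [b / 2^k / 2], the nonincreasing
    integrand is at least its value at the right end. *)
Let staircase t b n : 0 < b ->
  (\sum_(k < n) (b / 2 ^+ k / 2)%:E * G t (b / 2 ^+ k) <= int_G t b)%E.
Proof.
elim: n b => [|n IH] b b0.
  by rewrite big_ord0; apply: integral_ge0.
rewrite big_ord_recl/= expr0 divr1 addeC.
apply: le_trans (int_G_half t b0); rewrite leeD2r//.
apply: le_trans (IH (b / 2) _); last by rewrite divr_gt0.
rewrite le_eqVlt; apply/orP; left; apply/eqP; apply: eq_bigr => k _.
by rewrite /bump/= add1n exprS invfM mulrA.
Qed.

(** A null ball of positive radius would make the integrand [+oo] on an interval of positive length,
    hence [J] infinite. *)
Lemma dball_mass_gt0 b : 0 < b -> (J d mu b < +oo)%E ->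
  forall t u, 0 < u -> 0 < fine (mu (dball d t u)).
Proof.
move=> b0 Jb t u u0; rewrite lt_def mass_ge0 andbT; apply/eqP => m0.
pose v := Num.min u b; have v0 : 0 < v by rewrite lt_min u0.
have : (v%:E * G t v <= J d mu b)%E.
  apply: le_trans (int_G_const t (ltW v0)) _.
  apply: le_trans (le_int_G_J t b).
  apply: ge0_subset_integral => //=; first exact: mG.
  by apply: subset_itvl; rewrite bnd_simp ge_min lexx orbT.
have mv : mass t v = 0.
  apply/eqP; rewrite eq_le mass_ge0 andbT -[leRHS]m0; apply: le_dball_mass.
  by rewrite ge_min lexx.
by rewrite (Gy mv) gt0_muley ?lte_fin// leye_eq; move: Jb => /[swap] /eqP ->.
Qed.

Lemma dyadic_entropy_sum b j : 0 < b -> (J d mu b <= j%:E)%E ->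
  forall t n, \sum_(k < n) b / 2 ^+ k *
    Num.sqrt (ln (fine (mu (dball d t (b / 2 ^+ k))))^-1) <= 2 * j.
Proof.
move=> b0 Jb t n.
have m0 u : 0 < u -> 0 < mass t u.
  by apply: (dball_mass_gt0 b0); apply: le_lt_trans Jb _; rewrite ltry.
have := le_trans (staircase t n b0) (le_trans (le_int_G_J t b) Jb).
under eq_bigr => k _ do rewrite GE ?m0 ?divr_gt0 ?exprn_gt0//= -EFinM.
rewrite sumEFin lee_fin => h.
rewrite (_ : \sum_(k < n) _ = 2 * \sum_(k < n) (b / 2 ^+ k / 2 *
   Num.sqrt (ln (mass t (b / 2 ^+ k))^-1))); first by rewrite ler_pM2l.
by rewrite mulr_sumr; apply: eq_bigr => k _; field; rewrite expf_neq0.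
Qed.

Lemma J_ge_cst b (m : R) t : 0 <= b -> 0 < m -> fine (mu (dball d t b)) <= m ->
  ((b * Num.sqrt (ln m^-1))%:E <= J d mu b)%E.
Proof.
move=> b0 m0 tm; apply: le_trans (le_int_G_J t b).
apply: le_trans (int_G_const t b0); rewrite EFinM lee_wpmul2l ?lee_fin//.
have [m0'|m0'] := ltP 0 (mass t b); last first.
  by rewrite (@Gy t b) ?leey//; apply/eqP; rewrite eq_le m0' mass_ge0.
rewrite GE// lee_fin ler_wsqrtr// ler_ln ?posrE ?invr_gt0//.
by rewrite lef_pV2.
Qed.

Lemma J_ge0 b : (0 <= J d mu b)%E.
Proof. by apply: le_trans (le_int_G_J point b); exact: integral_ge0. Qed.

End entropy_integral.

(** * Transport of the majorizing measure to finitely many points *)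

Section discretization.
Context {R : realType} {T : ptopologicalType}.
Variables (d rho : T -> T -> R) (mu : probability (borelType T) R).
Hypothesis mB : forall t u, measurable (dball d t u : set (borelType T)).
Hypotheses (rho_ge0 : forall i j, 0 <= rho i j) (rhoxx : forall i, rho i i = 0).
Hypotheses (rhoC : forall i j, rho i j = rho j i).
Hypothesis rhoD : forall i j k, rho i k <= rho i j + rho j k.
Hypothesis rho_le : forall s t, rho s t <= d s t / 2.
Hypothesis rho_cont : forall a, continuous (fun t => rho t a).
Variable s : nat -> T.

Let near_set n (i : nat) : set (borelType T) :=
  \bigcap_(j in `I_n.+1) [set t | rho t (s i) <= rho t (s j)].

(* The part of [T] whose first nearest point among [s 0], ..., [s n] is [s i]. *)
Let cell n : nat -> set (borelType T) := seqDU (near_set n).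

Let measurable_near_set n i : measurable (near_set n i).
Proof.
apply: fin_bigcap_measurable; first exact: finite_II.
move=> j _; rewrite -[X in measurable X]setCK; apply: measurableC.
apply: sub_sigma_algebra.
rewrite (_ : ~` _ = (fun t => rho t (s i) - rho t (s j)) @^-1` [set x | 0 < x]).
  apply: open_comp; last exact: open_gt.
  by move=> t _; apply: cvgB; exact: rho_cont.
apply/seteqP; split => t /=; first by move=> /negP; rewrite -ltNge subr_gt0.
by rewrite subr_gt0 ltNge => /negP.
Qed.

Let measurable_cell n i : measurable (cell n i).
Proof. exact: seqDU_measurable. Qed.

Let cell_cover n t : exists2 i : 'I_n.+1, cell n i t &
  forall j : 'I_n.+1, rho t (s i) <= rho t (s j).
Proof.
have [i _ imin] := @arg_minP _ _ 'I_n.+1 ord0 xpredT (fun i => rho t (s i)) isT.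
have : (\big[setU/set0]_(k < n.+1) cell n k) t.
  rewrite -bigsetU_seqDU; apply: (bigsetU_sup (ltn_ord i)) => j /= jn.
  exact: (imin (Ordinal jn)).
rewrite -bigcup_mkord => -[k /= kn kt].
exists (Ordinal kn) => // j; case: kt => /= + _.
by move=> /(_ j (ltn_ord j)).
Qed.

Definition cell_weight n (i : 'I_n.+1) : R := fine (mu (cell n i)).

Let cell_weightE n (i : 'I_n.+1) : mu (cell n i) = (cell_weight i)%:E.
Proof. by rewrite fineK// fin_num_measure. Qed.

Lemma cell_weight_ge0 n (i : 'I_n.+1) : 0 <= cell_weight i.
Proof. by rewrite fine_ge0. Qed.

Lemma cell_weight_sum n : \sum_(i < n.+1) cell_weight i <= 1.
Proof.
rewrite -lee_fin -sumEFin; under eq_bigr do rewrite -cell_weightE.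
rewrite -(@measure_semi_additive_ord_I _ _ _ mu (cell n))//.
- by rewrite probability_le1//; exact: bigsetU_measurable.
- by apply: sub_trivIset (trivIset_seqDU _).
- exact: bigsetU_measurable.
Qed.

(** If [d t (s k) <= r] and [s i] is a nearest point to [t], then
    [rho t (s i) <= rho t (s k) <= r / 2], so [s i] is within [r] of [s k]. The factor 1/2 in
    [rho_le] pays for this detour through [t]. *)
Lemma le_ball_mass n (k : 'I_n.+1) r : fine (mu (dball d (s k) r)) <=
  ball_mass (@cell_weight n) (fun i j : 'I_n.+1 => rho (s i) (s j)) k r.
Proof.
pose A (i : 'I_n.+1) : set (borelType T) :=
  if rho (s i) (s k) <= r then cell n i else set0.
have mA i : measurable (A i) by rewrite /A; case: ifP.
rewrite -lee_fin fineK ?fin_num_measure// /ball_mass -sumEFin.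
under eq_bigr do rewrite -cell_weightE.
have -> : (\sum_(i < n.+1 | (rho (s i) (s k) <= r)%R) mu (cell n i) =
    \sum_(i < n.+1) mu (A i))%E.
  by rewrite big_mkcond/=; apply: eq_bigr => i _; rewrite /A;
     case: ifP; rewrite ?measure0.
have mUA : measurable (\big[setU/set0]_(i < n.+1) A i) by exact: bigsetU_measurable.
rewrite -measure_semi_additive_ord//.
  rewrite le_measure ?inE// => t /= tr.
  have [i it imin] := cell_cover n t.
  rewrite -bigcup_seq; exists i; first by rewrite /= mem_index_enum.
  rewrite /A ifT//; apply: le_trans (rhoD _ t _) _; rewrite rhoC.
  have := imin k; have := rho_le t (s k); move: tr; rewrite /dball/=; lra.
apply/trivIsetP => i j _ _ ij; rewrite /A.
have /trivIsetP := @trivIset_seqDU _ (near_set n).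
move=> /(_ i j I I ij) cij.
by case: ifP; case: ifP; rewrite ?set0I ?setI0.
Qed.

Lemma discrete_chaining n (x : T -> R) (K Z b j : R) (p q : 'I_n.+1) :
  (forall a c, rho (s a) (s c) = 0 -> x (s a) = x (s c)) ->
  0 < K -> 1 < Z ->
  \sum_(a < n.+1) \sum_(c < n.+1) cell_weight a * cell_weight c *
    expR (((x (s a) - x (s c)) / (K * rho (s a) (s c))) ^+ 2) <= Z ->
  0 < b -> (J d mu b <= j%:E)%E -> rho (s p) (s q) <= 2 * b ->
  `|x (s p) - x (s q)| <= K * (22 * j + 10 * b * Num.sqrt (ln Z)).
Proof.
move=> x_eq K0 Z1 ZZ b0 Jb pq.
have N0 (u : 'I_n.+1) r : 0 < r -> 0 < ball_mass (@cell_weight n)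
    (fun i j : 'I_n.+1 => rho (s i) (s j)) u r.
  move=> r0; apply: lt_le_trans (le_ball_mass u r).
  apply: (dball_mass_gt0 mB b0) => //.
  by apply: le_lt_trans Jb _; rewrite ltry.
apply: (@finite_chaining R 'I_n.+1 (@cell_weight n) (fun i => x (s i))
  (fun i j => rho (s i) (s j)) K Z) => //.
- exact: cell_weight_ge0.
- exact: cell_weight_sum.
- by move=> a c; exact: x_eq.
- move=> u m; apply: le_trans (dyadic_entropy_sum mB b0 Jb (s u) m).
  apply: ler_sum => k _; rewrite ler_wpM2l ?divr_ge0 ?exprn_ge0// ?(ltW b0)//.
  have r0 : 0 < b / 2 ^+ k by rewrite divr_gt0// exprn_gt0.
  have m0 : 0 < fine (mu (dball d (s u) (b / 2 ^+ k))).
    apply: (dball_mass_gt0 mB b0) => //.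
    by apply: le_lt_trans Jb _; rewrite ltry.
  rewrite ler_wsqrtr// ler_ln ?posrE ?invr_gt0 ?N0//.
  by rewrite lef_pV2 ?posrE ?N0// le_ball_mass.
Qed.

End discretization.

(** * The Orlicz pseudometric of the increments *)

Section psi2_distance.
Context {R : realType} {d0 : measure_display} {Omega : measurableType d0}.
Variables (P : probability Omega R) (T : Type) (X : T -> Omega -> R).
Hypothesis mX : forall t, measurable_fun setT (X t).

Let E s t (c : R) : \bar R :=
  (\int[P]_w (expR (((X s w - X t w) / c) ^+ 2))%:E)%E.

Definition psi2_bounds (s t : T) : set R :=
  [set c | 0 < c /\ (E s t c <= 2%:E)%E].

(* The norm of [X s - X t] in the Orlicz space of [exp (x^2) - 1]. *)
Definition psi2_dist (s t : T) : R := inf (psi2_bounds s t).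

Lemma measurable_psi2_integrand s t (c : R) :
  measurable_fun setT (fun w => expR (((X s w - X t w) / c) ^+ 2)).
Proof.
apply: measurableT_comp => //; apply: measurable_funX.
by apply: measurable_funM => //; exact: measurable_funB.
Qed.

Let mE s t c : measurable_fun setT
  (fun w => (expR (((X s w - X t w) / c) ^+ 2))%:E).
Proof. by apply/measurable_EFinP; exact: measurable_psi2_integrand. Qed.

Variable D : T -> T -> R.
Hypothesis D_ge0 : forall s t, 0 <= D s t.
Hypothesis XD : forall s t c, 0 < c -> D s t <= 2 * c -> (E s t c <= 2%:E)%E.

Let lbounds s t : has_lbound (psi2_bounds s t).
Proof. by exists 0 => c [/ltW]. Qed.

Let bounds_neq0 s t : psi2_bounds s t !=set0.
Proof.
exists (D s t + 1); have := D_ge0 s t => Dst.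
by split; [lra|apply: XD; lra].
Qed.

Lemma psi2_dist_ge0 s t : 0 <= psi2_dist s t.
Proof. by apply: lb_le_inf => // c [/ltW]. Qed.

Lemma psi2_dist_le s t : psi2_dist s t <= D s t / 2.
Proof.
apply/ler_addgt0Pr => e e0; apply: ge_inf => //.
have := D_ge0 s t => Dst.
by split; [lra|apply: XD; lra].
Qed.

Lemma psi2_distxx s : psi2_dist s s = 0.
Proof.
apply/eqP; rewrite eq_le psi2_dist_ge0 andbT; apply/ler_addgt0Pr => e e0.
rewrite add0r; apply: ge_inf => //; split => //.
rewrite /E; under eq_integral do rewrite subrr mul0r expr0n/= expR0.
by rewrite integral_cst//= probability_setT mule1 lee_fin ler1n.
Qed.

Lemma psi2_distC s t : psi2_dist s t = psi2_dist t s.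
Proof.
rewrite /psi2_dist; congr inf; apply/seteqP.
by split => c [c0 h]; split => //; move: h; rewrite /E;
  under eq_integral do rewrite -sqrrN -mulNr opprB.
Qed.

(** [(a + b) / (p + q)] is the mean of [a / p] and [b / q] with weights proportional to [p] and [q];
    convexity of the square and the tangent of [expR] at [m] then give Jensen's inequality. This is
    what makes [p + q] admissible in the triangle inequality. *)
Let expR_sqr_convex (a b p q : R) : 0 < p -> 0 < q ->
  expR (((a + b) / (p + q)) ^+ 2) <=
  p / (p + q) * expR ((a / p) ^+ 2) + q / (p + q) * expR ((b / q) ^+ 2).
Proof.
move=> p0 q0; set l := p / (p + q); set l' := q / (p + q).
have pq0 : 0 < p + q by lra.
have l0 : 0 <= l by rewrite divr_ge0 ?ltW.
have l'0 : 0 <= l' by rewrite divr_ge0 ?ltW.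
have ll' : l + l' = 1 by rewrite -mulrDl divff// gt_eqF.
set x := a / p; set y := b / q.
have -> : (a + b) / (p + q) = l * x + l' * y.
  by rewrite /l /l' /x /y; field; rewrite !gt_eqF.
pose m := l * x ^+ 2 + l' * y ^+ 2.
apply: (@le_trans _ _ (expR m)).
  rewrite ler_expR /m -subr_ge0 (_ : _ - _ = l * l' * (x - y) ^+ 2).
    by rewrite mulr_ge0 ?sqr_ge0// mulr_ge0.
  by have -> : l' = 1 - l by [lra]; ring.
have tangent u : expR m * (1 + (u - m)) <= expR u.
  have -> : expR u = expR m * expR (u - m) by rewrite -expRD; congr expR; ring.
  by rewrite ler_pM2l ?expR_gt0// expR_ge1Dx.
have := ler_wpM2l l0 (tangent (x ^+ 2)).
have := ler_wpM2l l'0 (tangent (y ^+ 2)).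
suff : l * (expR m * (1 + (x ^+ 2 - m))) + l' * (expR m * (1 + (y ^+ 2 - m))) =
  expR m by lra.
transitivity (expR m * (l + l' + (m - (l + l') * m))); first by rewrite /m; ring.
by rewrite ll'; ring.
Qed.

Lemma psi2_distD s t u : psi2_dist s u <= psi2_dist s t + psi2_dist t u.
Proof.
rewrite -lerBlDr; apply: lb_le_inf => // p [p0 Ep].
rewrite lerBlDr addrC -lerBlDr; apply: lb_le_inf => // q [q0 Eq].
rewrite lerBlDr addrC; apply: ge_inf => //; split; first exact: addr_gt0.
have pq0 : 0 < p + q by exact: addr_gt0.
have l0 : 0 <= p / (p + q) by rewrite divr_ge0 ?ltW.
have l'0 : 0 <= q / (p + q) by rewrite divr_ge0 ?ltW.
apply: (@le_trans _ _ (\int[P]_w ((p / (p + q))%:E *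
    (expR (((X s w - X t w) / p) ^+ 2))%:E +
    (q / (p + q))%:E * (expR (((X t w - X u w) / q) ^+ 2))%:E))%E).
  apply: ge0_le_integral => //.
  - by apply: emeasurable_funD; apply: emeasurable_funM.
  - move=> w _; rewrite -!EFinM -EFinD lee_fin.
    rewrite (_ : X s w - X u w = (X s w - X t w) + (X t w - X u w)); last by ring.
    exact: expR_sqr_convex.
rewrite ge0_integralD//; last 4 first.
- by move=> w _; rewrite -EFinM lee_fin mulr_ge0// expR_ge0.
- exact: emeasurable_funM.
- by move=> w _; rewrite -EFinM lee_fin mulr_ge0// expR_ge0.
- exact: emeasurable_funM.
rewrite !ge0_integralZl//.
apply: (@le_trans _ _ ((p / (p + q))%:E * 2%:E + (q / (p + q))%:E * 2%:E)%E).
  by apply: leeD; apply: lee_wpmul2l => //; rewrite lee_fin.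
rewrite -!EFinM -EFinD lee_fin -mulrDl -mulrDl divff ?mul1r// gt_eqF//.
Qed.

Lemma psi2_dist_lt s t c : psi2_dist s t < c -> (E s t c <= 2%:E)%E.
Proof.
move=> /(inf_lt (bounds_neq0 s t)) [p [p0 Ep] pc].
apply: le_trans Ep; apply: ge0_le_integral => // w _.
rewrite lee_fin ler_expR !expr_div_n ler_wpM2l ?sqr_ge0//.
have c0 : 0 < c by exact: lt_trans pc.
rewrite lef_pV2 ?posrE ?exprn_gt0//.
by rewrite lerXn2r ?nnegrE ?ltW.
Qed.

(** Since [1 + y <= expR y], the second moment of [X s - X t] is at most [2 e^2] for every [e > 0],
    hence zero. *)
Lemma psi2_dist_eq0 s t : psi2_dist s t = 0 ->
  {ae P, forall w, X s w = X t w}.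
Proof.
move=> st0.
pose f w := (((X s w - X t w) ^+ 2)%:E : \bar R).
have mf : measurable_fun setT f.
  by apply/measurable_EFinP; apply: measurable_funX; exact: measurable_funB.
have f0 w : (0 <= f w)%E by rewrite lee_fin sqr_ge0.
have If e : 0 < e -> (\int[P]_w f w <= (2 * e ^+ 2)%:E)%E.
  move=> e0; have : (E s t e <= 2%:E)%E by apply: psi2_dist_lt; rewrite st0.
  have e2 : 0 < e ^+ 2 by rewrite exprn_gt0.
  move=> h; rewrite mulrC EFinM.
  apply: (le_trans _ (lee_wpmul2l _ h)); last by rewrite lee_fin ltW.
  rewrite -ge0_integralZl//; last by rewrite lee_fin ltW.
  apply: ge0_le_integral => //; first exact: emeasurable_funM.
  move=> w _; rewrite -EFinM lee_fin.
  apply: le_trans (ler_wpM2l (ltW e2) (expR_ge1Dx _)).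
  rewrite mulrDr mulr1 expr_div_n mulrCA divff ?mulr1 ?gt_eqF//.
  by rewrite lerDr ltW.
have I0 : (\int[P]_w f w = 0)%E.
  apply/eqP; rewrite eq_le integral_ge0 ?andbT//; apply/lee_addgt0Pr => e e0.
  rewrite add0e; apply: le_trans (If (Num.sqrt (e / 2)) _) _.
    by rewrite sqrtr_gt0 divr_gt0.
  have e2 : 0 <= e / 2 by lra.
  by rewrite lee_fin (sqr_sqrtr e2); lra.
have : (\int[P]_w `|f w| = 0)%E.
  by rewrite -I0; apply: eq_integral => w _; rewrite gee0_abs.
move=> /(ae_eq_integral_abs _ measurableT mf); apply: filterS => w /(_ I).
by rewrite /f => -[] /eqP; rewrite sqrf_eq0 subr_eq0 => /eqP.
Qed.

End psi2_distance.

(** * Almost sure chaining along a sequence *)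

Section almost_sure_chaining.
Context {R : realType} {dO : measure_display} {Omega : measurableType dO}.
Context {T : ptopologicalType}.
Variables (P : probability Omega R) (X : T -> Omega -> R).
Variables (d : T -> T -> R) (mu : probability (borelType T) R).
Hypothesis mX : forall t, measurable_fun setT (X t).
Hypothesis d_ge0 : forall s t, 0 <= d s t.
Hypothesis Xd : forall s t (c : R), 0 < c -> d s t <= 2 * c ->
  (\int[P]_w (expR (((X s w - X t w) / c) ^+ 2))%:E <= 2%:E)%E.
Hypothesis mB : forall t u, measurable (dball d t u : set (borelType T)).
Let rho := psi2_dist P X.
Hypothesis rho_cont : forall a, continuous (fun t => rho t a).

Lemma as_chaining (s : nat -> T) : {ae P, forall w, exists2 C : R, 0 <= C &
  forall b j p q, 0 < b -> (J d mu b <= j%:E)%E -> rho (s p) (s q) <= 2 * b ->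
    `|X (s p) w - X (s q) w| <= 5 / 4 * (22 * j + 10 * b * C)}.
Proof.
have rho_ge0 := psi2_dist_ge0 d_ge0 Xd.
pose W n (a : 'I_n.+1) := cell_weight rho mu s a.
have W0 n (a : 'I_n.+1) : 0 <= W n a by exact: cell_weight_ge0.
(* The factor [5/4] puts the scale strictly above the infimum defining [rho], so that the
   exponential moment is at most [2]. At distance zero the quotient is [0] and the exponential is
   [1]. *)
pose e a c w := expR (((X (s a) w - X (s c) w) / (5 / 4 * rho (s a) (s c))) ^+ 2).
pose Z n w := \sum_(a < n.+1) \sum_(c < n.+1) W n a * W n c * e a c w.
have me a c : measurable_fun setT (e a c) by exact: measurable_psi2_integrand.
have Ee a c : (\int[P]_w (e a c w)%:E <= 2%:E)%E.
  have [r0|r0] := eqVneq (rho (s a) (s c)) 0.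
    rewrite /e r0; under eq_integral do rewrite mulr0 invr0 mulr0 expr0n/= expR0.
    by rewrite integral_cst//= probability_setT mule1 lee_fin ler1n.
  apply: (psi2_dist_lt mX d_ge0 Xd).
  have : 0 < rho (s a) (s c) by rewrite lt_def r0 rho_ge0.
  by rewrite /rho; lra.
have mZ n : measurable_fun setT (fun w => (Z n w)%:E).
  apply/measurable_EFinP; apply: measurable_sum => a.
  by apply: measurable_sum => c; exact: measurable_funM.
have Z0 n w : (0 <= (Z n w)%:E)%E.
  rewrite lee_fin; apply: sumr_ge0 => a _; apply: sumr_ge0 => c _.
  by rewrite !mulr_ge0// expR_ge0.
have EZ n : (\int[P]_w (Z n w)%:E <= 2%:E)%E.
  have -> : (\int[P]_w (Z n w)%:E = \sum_(a < n.+1) \sum_(c < n.+1)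
      (W n a * W n c)%:E * \int[P]_w (e a c w)%:E)%E.
    rewrite /Z; under eq_integral do rewrite -sumEFin.
    rewrite ge0_integral_sum//; last 2 first.
    - move=> a; apply/measurable_EFinP.
      by apply: measurable_sum => c; exact: measurable_funM.
    - move=> a w _; rewrite lee_fin; apply: sumr_ge0 => c _.
      by rewrite !mulr_ge0// expR_ge0.
    apply: eq_bigr => a _; under eq_integral do rewrite -sumEFin.
    rewrite ge0_integral_sum//; last 2 first.
    - by move=> c; apply/measurable_EFinP; exact: measurable_funM.
    - by move=> c w _; rewrite lee_fin !mulr_ge0// expR_ge0.
    apply: eq_bigr => c _; under eq_integral do rewrite EFinM.
    rewrite ge0_integralZl//.
    - exact/measurable_EFinP.
    - by move=> w _; rewrite lee_fin expR_ge0.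
    - by rewrite lee_fin mulr_ge0.
  apply: (@le_trans _ _ (\sum_(a < n.+1) \sum_(c < n.+1) (W n a * W n c * 2)%:E)%E).
    apply: lee_sum => a _; apply: lee_sum => c _; rewrite [leRHS]EFinM.
    by apply: lee_wpmul2l; rewrite ?lee_fin ?mulr_ge0.
  under eq_bigr do rewrite sumEFin; rewrite sumEFin lee_fin.
  under eq_bigr do rewrite -mulr_suml -mulr_sumr; rewrite -mulr_suml -mulr_suml.
  rewrite ler_piMl//; have S0 : 0 <= \sum_(i < n.+1) W n i by exact: sumr_ge0.
  by rewrite mulr_ile1//; exact: cell_weight_sum.
(* By Fatou's lemma [L] has mean at most [2], so it is almost surely finite. A lower limit suffices:
   for given [p] and [q] a single [n] beyond both with [Z n w <= K] is needed, and [K] depends on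
   [w] alone. *)
pose L w : \bar R := limn_einf (fun n => (Z n w)%:E).
have mL : measurable_fun setT L.
  rewrite /L /limn_einf; apply: measurableT_comp => //.
  by apply: measurable_fun_limn_esup => n; exact: measurableT_comp.
have L0 w : (0 <= L w)%E.
  rewrite /L limn_einf_lim; apply: lime_ge; first exact: is_cvg_einfs.
  by apply: nearW => n; apply: le_ereal_inf_tmp => _ [k _ <-].
have iL : P.-integrable setT L.
  apply/integrableP; split => //; under eq_integral do rewrite gee0_abs//.
  apply: (@le_lt_trans _ _ 2%:E); last exact: ltry.
  apply: le_trans (fatou P measurableT mZ (fun n w _ => Z0 n w)) _.
  rewrite limn_einf_lim; apply: lime_le; first exact: is_cvg_einfs.
  apply: nearW => n; apply: le_trans (EZ n); apply: ereal_inf_lbound.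
  by exists n => /=.
have eqX : {ae P, forall w, forall p q,
    rho (s p) (s q) = 0 -> X (s p) w = X (s q) w}.
  apply/ae_foralln => p; apply/ae_foralln => q.
  have [r0|r0] := eqVneq (rho (s p) (s q)) 0; last first.
    by apply: aeW => w /eqP; rewrite (negbTE r0).
  by apply: filterS (psi2_dist_eq0 mX d_ge0 Xd r0) => w.
apply: filterS2 eqX (integrable_ae measurableT iL) => w Xeq /(_ I) Lfin.
(* Adding [2] puts [K] above both [L w] and [1], the latter being required of the constant in the
   chaining bound. *)
pose K := fine (L w) + 2.
have LK : (L w < K%:E)%E by rewrite -[ltLHS](fineK Lfin) lte_fin ltrDl.
have K1 : 1 < K by have := fine_ge0 (L0 w); rewrite /K; lra.
exists (Num.sqrt (ln K)); first exact: sqrtr_ge0.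
move=> b j p q b0 Jb pq.
have [n mn Zn] : exists2 n, (maxn p q <= n)%N & Z n w <= K.
  have : (einfs (fun n => (Z n w)%:E) (maxn p q) < K%:E)%E.
    apply: le_lt_trans LK; rewrite /L limn_einf_lim.
    rewrite (cvg_lim _ (ereal_nondecreasing_cvgn (@nondecreasing_einfs _ _)))//.
    apply: ereal_sup_ubound.
    by exists (maxn p q).
  move=> /ereal_inf_lt[_ /= [n mn <-]]; rewrite lte_fin => /ltW Zn.
  by exists n.
have pn : (p < n.+1)%N by rewrite ltnS (leq_trans _ mn)// leq_maxl.
have qn : (q < n.+1)%N by rewrite ltnS (leq_trans _ mn)// leq_maxr.
have K54 : 0 < 5 / 4 :> R by lra.
have rhoxx : forall i, rho i i = 0 := psi2_distxx d_ge0 Xd.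
have rhoC : forall i j, rho i j = rho j i := @psi2_distC _ _ _ P T X.
have rhoD : forall i j k, rho i k <= rho i j + rho j k := psi2_distD mX d_ge0 Xd.
have rho_le : forall s t, rho s t <= d s t / 2 := psi2_dist_le d_ge0 Xd.
exact: (@discrete_chaining R T d rho mu mB rho_ge0 rhoxx rhoC rhoD rho_le
  rho_cont s n (X^~ w) (5 / 4) K b j (Ordinal pn) (Ordinal qn)
  Xeq K54 K1 Zn b0 Jb pq).
Qed.

End almost_sure_chaining.

(** * Continuous versions and their modulus *)

Section finite_cover.
Context {R : realType} {T : ptopologicalType}.
Variables (d rho : T -> T -> R) (mu : probability (borelType T) R).

(** Otherwise a greedy choice produces infinitely many pairwise disjoint sets of mass at least [e],
    and more than [1 / e] of them exceed total mass [1]. *)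
Lemma finite_intersecting_family (A : T -> set (borelType T)) (e : R) :
  0 < e -> (forall t, measurable (A t)) -> (forall t, (e%:E <= mu (A t))%E) ->
  exists F : seq T, forall t, exists2 s, s \in F & A t `&` A s !=set0.
Proof.
move=> e0 mA eA; apply: contrapT => noF.
have /choice[g gP] : forall F : seq T, exists t, forall s, s \in F -> A t `&` A s = set0.
  move=> F; apply: contrapT => nt; apply: noF; exists F => t.
  apply: contrapT => nF; apply: nt; exists t => s sF.
  by apply: contrapT => /eqP/set0P ts; apply: nF; exists s.
pose l := fix l n := if n is m.+1 then g (l m) :: l m else [::].
pose u n := g (l n).
have ul i n : (i < n)%N -> u i \in l n.
  elim: n => // n IH; rewrite ltnS leq_eqVlt => /orP[/eqP ->|/IH].
    by rewrite mem_head.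
  by rewrite /= inE => ->; rewrite orbT.
have tu : trivIset setT (A \o u).
  apply/trivIsetP => i j _ _; wlog ij : i j / (i < j)%N => [wl|_].
    rewrite neq_ltn => /orP[ij|ji]; first by apply: wl => //; rewrite ltn_eqF.
    by rewrite setIC; apply: wl => //; rewrite ltn_eqF.
  by rewrite setIC; apply: gP; exact: ul.
pose n := (Num.bound e^-1).
have : (mu (\big[setU/set0]_(i < n) (A \o u) i) <= 1)%E.
  by apply: probability_le1; apply: bigsetU_measurable => i _; exact: mA.
rewrite (@measure_semi_additive_ord_I _ _ _ mu (A \o u)); last 3 first.
- by move=> k _; exact: mA.
- exact: sub_trivIset tu.
- by apply: bigsetU_measurable => i _; exact: mA.
apply/negP; rewrite -ltNge; apply: (@lt_le_trans _ _ (\sum_(i < n) e%:E)%E); last first.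
  by apply: lee_sum => i _; exact: eA.
rewrite sumEFin lte_fin sumr_const card_ord -mulr_natr mulrC -ltr_pdivrMr// div1r.
by apply: archi_boundP; rewrite invr_ge0 ltW.
Qed.

Lemma positive_gap (l : seq R) :
  exists2 e : R, 0 < e & forall x, x \in l -> x < e -> x <= 0.
Proof.
elim: l => [|y l [e e0 el]]; first by exists 1.
have [y0|y0] := leP y 0.
  by exists e => // x; rewrite inE => /orP[/eqP ->//|/el].
exists (Num.min e y); first by rewrite lt_min e0.
move=> x; rewrite inE lt_min => /orP[/eqP -> /andP[_]|xl /andP[xe _]].
  by rewrite ltxx.
exact: el.
Qed.

Hypothesis mB : forall t u, measurable (dball d t u : set (borelType T)).
Hypotheses (rho_ge0 : forall i j, 0 <= rho i j).
Hypotheses (rhoC : forall i j, rho i j = rho j i).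
Hypothesis rhoD : forall i j k, rho i k <= rho i j + rho j k.
Hypothesis rho_le : forall s t, rho s t <= d s t / 2.

Let measurable_class t :
  measurable (\bigcap_n dball d t n.+1%:R^-1 : set (borelType T)).
Proof. exact: bigcap_measurable. Qed.

(* Either some balls have arbitrarily small mass, and [J] dominates every linear
   function near [0], or [T] has finitely many points up to [rho]-distance [0]. *)
Lemma entropy_dichotomy :
  (forall M : R, exists2 e : R, 0 < e &
     forall b, 0 < b < e -> ((M * b)%:E <= J d mu b)%E) \/
  (exists2 e : R, 0 < e & forall s t, rho s t < e -> rho s t = 0).
Proof.
have [[e e0 He]|He] := pselect (exists2 e : R, 0 < e &
    forall t u, 0 < u -> e <= fine (mu (dball d t u))); [right|left].
  (* The intersections keep mass at least [e] by continuity from above, and two that meet have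
     centres at [rho]-distance zero. A finite intersecting family therefore represents all points,
     and finitely many distances leave a positive gap. *)
  pose A t : set (borelType T) := \bigcap_n dball d t n.+1%:R^-1.
  have eA t : (e%:E <= mu (A t))%E.
    have cv : mu (dball d t n.+1%:R^-1) @[n --> \oo] --> mu (A t).
      apply: nonincreasing_cvg_mu => //.
      - by rewrite -ge0_fin_numE// fin_num_measure.
      - move=> m n mn; apply/subsetPset => s; rewrite /dball/= => /le_trans; apply.
        by rewrite lef_pV2 ?posrE// ler_nat.
    rewrite -(cvg_lim _ cv)//; apply: lime_ge; first by apply/cvg_ex; eexists; exact: cv.
    apply: nearW => n; rewrite -(fineK (fin_num_measure mu _ (mB t n.+1%:R^-1))).
    by rewrite lee_fin He.
  have [F HF] := finite_intersecting_family e0 measurable_class eA.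
  have A0 t s x : A t x -> A s x -> rho t s = 0.
    move=> tx sx; apply/eqP; rewrite eq_le rho_ge0 andbT.
    apply/ler_addgt0Pr => c c0; rewrite add0r.
    have [n nc] : exists n, n.+1%:R^-1 <= c.
      exists (Num.bound c^-1); rewrite invf_ple ?posrE//.
      apply: ltW; apply: (lt_trans (archi_boundP _)); first by rewrite invr_ge0 ltW.
      by rewrite ltr_nat.
    apply: le_trans (rhoD _ x _) _; rewrite rhoC.
    have dxt : d x t <= n.+1%:R^-1 := tx n I.
    have dxs : d x s <= n.+1%:R^-1 := sx n I.
    apply: le_trans (lerD (rho_le x t) (rho_le x s)) _.
    by have := le_trans dxt nc; have := le_trans dxs nc; lra.
  have [c c0 cF] := positive_gap [seq rho x y | x <- F, y <- F].
  exists c => // s t st.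
  have [x xF [z [sz xz]]] := HF s; have [y yF [z' [tz yz]]] := HF t.
  have sx := A0 _ _ _ sz xz; have ty := A0 _ _ _ tz yz.
  have xy : rho x y <= 0.
    apply: cF; first by apply/allpairsP; exists (x, y).
    have := rhoD x s y; have := rhoD s t y; rewrite (rhoC x s); lra.
  apply/eqP; rewrite eq_le rho_ge0 andbT.
  have := rhoD s x t; have := rhoD x y t; rewrite (rhoC y t); lra.
(* With this mass, [Num.sqrt (ln m^-1)] is [|M|], so a ball of smaller mass gives [J] slope at least
   [M] at all radii below its own. *)
move=> M; pose m := expR (- M ^+ 2).
have [t [u u0 tu]] : exists t, exists2 u, 0 < u & fine (mu (dball d t u)) < m.
  apply: contrapT => ne; apply: He; exists m; first exact: expR_gt0.
  move=> t u u0; rewrite leNgt; apply/negP => h; apply: ne; exists t.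
  by exists u.
exists u => // b /andP[b0 bu].
have bm : fine (mu (dball d t b)) <= m.
  by apply: le_trans (ltW tu); exact: le_dball_mass (ltW bu).
apply: le_trans (J_ge_cst mB (ltW b0) (expR_gt0 _) bm).
rewrite lee_fin mulrC ler_pM2l// /m -expRN opprK expRK sqrtr_sqr.
exact: ler_norm.
Qed.

End finite_cover.

(** * Construction of the version *)

Section continuous_version.
Context {R : realType} {dO : measure_display} {Omega : measurableType dO}.
Context {T : ptopologicalType}.
Variables (P : probability Omega R) (X : T -> Omega -> R).
Variables (d rho : T -> T -> R) (mu : probability (borelType T) R).
Hypothesis d_ge0 : forall s t, 0 <= d s t.
Hypothesis dxx : forall t, d t t = 0.
Hypothesis d_cont : continuous (fun xy : T * T => d xy.1 xy.2).
Hypotheses (rhoC : forall s t, rho s t = rho t s).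
Hypothesis rhoD : forall s t u, rho s u <= rho s t + rho t u.
Hypothesis rho_le : forall s t, rho s t <= d s t / 2.

Let d_contl t : continuous (fun s => d s t).
Proof.
move=> s; apply: (@continuous_comp _ _ _ (fun s => (s, t)) (fun xy => d xy.1 xy.2)).
  by apply: cvg_pair; [exact: cvg_id|exact: cvg_cst].
exact: d_cont.
Qed.

Lemma near_pseudometric t (e : R) : 0 < e -> \forall s \near t, rho s t < e.
Proof.
move=> e0; have := @cvgr_lt _ _ _ _ _ _ (@d_contl t t) e.
rewrite dxx => /(_ _ e0); apply: filterS => s st.
have := rho_le s t; have := d_ge0 s t; lra.
Qed.

Lemma pseudometric_continuous a : continuous (fun t => rho t a).
Proof.
move=> t; apply/cvgrPdist_lt => e e0.
apply: filterS (near_pseudometric t e0) => s st.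
rewrite ltr_distl; have := rhoD s t a; have := rhoD t s a.
by rewrite (rhoC t s); lra.
Qed.

Lemma measurable_dball t u : measurable (dball d t u : set (borelType T)).
Proof.
rewrite -[X in measurable X]setCK; apply: measurableC; apply: sub_sigma_algebra.
rewrite (_ : ~` _ = (fun s => d s t) @^-1` [set x | u < x]).
  by apply: open_comp; [move=> s _; exact: d_contl|exact: open_gt].
by apply/seteqP; split => s /=; rewrite /dball/= ltNge => /negP.
Qed.

Hypothesis J0 : J d mu b @[b --> 0^'+] --> 0%E.

Lemma J_small (e : R) : 0 < e ->
  exists2 c : R, 0 < c & forall b, 0 < b < c -> (J d mu b <= e%:E)%E.
Proof.
move=> e0; have : \forall b \near 0^'+, (J d mu b < e%:E)%E.
  have /fine_cvgP[finJ cJ] := J0.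
  apply: filterS2 finJ (cvgr_lt _ cJ _ e0) => b bfin.
  by rewrite -lte_fin /= fineK.
move=> [c /= c0 Hc]; exists c => // b /andP[b0 bc]; apply/ltW/Hc => //=.
by rewrite sub0r normrN gtr0_norm.
Qed.

Lemma small_J_bound (C e : R) : 0 <= C -> 0 < e -> exists b j : R,
  [/\ 0 < b, (J d mu b <= j%:E)%E & 5 / 4 * (22 * j + 10 * b * C) < e].
Proof.
move=> C0 e0; have [c c0 Hc] := @J_small (e / 100) (divr_gt0 e0 (ltr0n _ 100)).
pose b := Num.min (c / 2) (e / (50 * (C + 1))).
have C50 : 0 < 50 * (C + 1) by lra.
have b0 : 0 < b by rewrite lt_min !divr_gt0.
exists b, (e / 100); split => //.
  by apply: Hc; rewrite b0/= gt_min; apply/orP; left; lra.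
have : b * (50 * (C + 1)) <= e by rewrite -ler_pdivlMr// ge_min lexx orbT.
by lra.
Qed.

Hypothesis mX : forall t, measurable_fun setT (X t).
Hypothesis sepT : separable_space T.
Hypothesis chaining : forall s : nat -> T,
  {ae P, forall w, exists2 C : R, 0 <= C &
    forall b j p q, 0 < b -> (J d mu b <= j%:E)%E -> rho (s p) (s q) <= 2 * b ->
      `|X (s p) w - X (s q) w| <= 5 / 4 * (22 * j + 10 * b * C)}.

Let dense_seq : exists s : nat -> T, forall t (e : R), 0 < e ->
  exists k, rho t (s k) < e.
Proof.
have [D cD dD] := sepT.
have [s sD] : exists s : nat -> T, forall t, D t -> exists k, s k = t.
  move/pcard_surjP : cD => [s sD]; exists s => t Dt.
  by have [k _ sk] := sD t Dt; exists k.
exists s => t e e0.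
have : nbhs t [set u | rho u t < e] by exact: near_pseudometric.
rewrite nbhsE => -[U [oU Ut] UD].
have [u [Uu Du]] := dD U (ex_intro _ t Ut) oU.
by have [k sk] := sD u Du; exists k; rewrite sk rhoC; exact: UD.
Qed.

Theorem continuous_version : exists Y : T -> Omega -> R,
  [/\ forall t, measurable_fun setT (Y t),
      forall t, {ae P, forall w, Y t w = X t w} &
      {ae P, forall w, exists2 C : R, 0 <= C &
        forall b j p q, 0 < b -> (J d mu b <= j%:E)%E -> rho p q < 2 * b ->
          `|Y p w - Y q w| <= 5 / 4 * (22 * j + 10 * b * C)}].
Proof.
have [s sP] := dense_seq.
have /choice[n nP] : forall tk : T * nat, exists i, rho tk.1 (s i) < tk.2.+1%:R^-1.
  by move=> [t k]; apply: sP; rewrite invr_gt0.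
pose u t w k := X (s (n (t, k))) w.
(* The upper limit along approximating points is measurable and defined for every [w]; almost surely
   it is a genuine limit. *)
pose Y t w := fine (limn_esup (fun k => (u t w k)%:E)).
have uY t w y : u t w k @[k --> \oo] --> y -> Y t w = y.
  move=> uy; have cu : ((u t w k)%:E @[k --> \oo] --> y%:E)%E.
    by apply/fine_cvgP; split; [exact: nearW|exact: uy].
  rewrite /Y is_cvg_limn_esupE; last by apply/cvg_ex; exists y%:E.
  by rewrite (cvg_lim _ cu).
have ninf (e : R) : 0 < e -> \forall k \near \oo, k.+1%:R^-1 < e.
  move=> e0; near=> k; rewrite invf_plt ?posrE//.
  by rewrite (@lt_le_trans _ _ k%:R) ?ler_nat//; near: k; exact: nbhs_infty_gtr.
exists Y; split.
- move=> t; apply: measurableT_comp => //; apply: measurable_fun_limn_esup => k.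
  by apply/measurable_EFinP; exact: mX.
(* Prepending [t] to the dense sequence, at the cost of an index shift, lets the chaining bound
   compare [X t] itself with its approximations, outside a null set depending on [t]. *)
- move=> t; pose s' k := if k is k'.+1 then s k' else t.
  have := chaining s'.
  apply: filterS => w [C C0 HC]; apply: uY; apply/cvgrPdist_le => e e0.
  have [b [j [b0 Jb be]]] := small_J_bound C0 e0.
  have b2 : 0 < 2 * b by rewrite mulr_gt0.
  apply: filterS (ninf _ b2) => k kb.
  apply: le_trans (ltW be); apply: (HC b j 0%N (n (t, k)).+1) => //=.
  exact: le_trans (ltW (nP (t, k))) (ltW kb).
- have := chaining s.
  apply: filterS => w [C C0 HC]; exists C => //.
  (* The strict inequality on [rho p q] leaves room for the two approximation errors. The
     exceptional null set here is common to all [p] and [q]. *)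
  have close p q (c : R) : rho p q < c ->
      \forall k \near \oo, rho (s (n (p, k))) (s (n (q, k))) <= c.
    move=> pqc; have h0 : 0 < (c - rho p q) / 2 by lra.
    apply: filterS (ninf _ h0) => k kc.
    have := rhoD (s (n (p, k))) p (s (n (q, k))); have := rhoD p q (s (n (q, k))).
    have := lt_trans (nP (p, k)) kc; have := lt_trans (nP (q, k)) kc.
    by rewrite /= (rhoC p (s (n (p, k)))); lra.
  have cu p : u p w k @[k --> \oo] --> Y p w.
    suff : cvgn (u p w) by move=> /cvg_ex[y uy]; rewrite (uY _ _ _ uy).
    apply/cauchy_cvgP/cauchy_ballP => e e0.
    have [b [j [b0 Jb be]]] := small_J_bound C0 e0.
    have [N _ HN] := ninf _ b0.
    exists ([set u p w k | k in [set k | (N <= k)%N]],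
            [set u p w k | k in [set k | (N <= k)%N]]) => /=.
      by split; exists N => // k /= Nk; exists k.
    move=> [x y] /= [[k Nk <-] [l Nl <-]]; rewrite /ball/=.
    apply: le_lt_trans be; apply: HC => //.
    have := rhoD (s (n (p, k))) p (s (n (p, l))).
    have := lt_trans (nP (p, k)) (HN _ Nk); have := lt_trans (nP (p, l)) (HN _ Nl).
    by rewrite /= (rhoC p (s (n (p, k)))); lra.
  move=> b j p q b0 Jb pq.
  have cuv : `|u p w k - u q w k| @[k --> \oo] --> `|Y p w - Y q w|.
    by apply: cvg_norm; apply: cvgB.
  rewrite -(cvg_lim _ cuv)//; apply: limr_le.
    by apply/cvg_ex; eexists; exact: cuv.
  by apply: filterS (close _ _ _ pq) => k kb; exact: HC.
Unshelve. all: by end_near. Qed.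

End continuous_version.

(** * Boundedness, continuity and modulus of a path *)

Section path_modulus.
Context {R : realType} {T : ptopologicalType}.
Variables (d rho : T -> T -> R) (mu : probability (borelType T) R).
Hypothesis d_ge0 : forall s t, 0 <= d s t.
Hypothesis dxx : forall t, d t t = 0.
Hypothesis d_cont : continuous (fun xy : T * T => d xy.1 xy.2).
Hypotheses (rho_ge0 : forall s t, 0 <= rho s t).
Hypotheses (rhoC : forall s t, rho s t = rho t s).
Hypothesis rhoD : forall s t u, rho s u <= rho s t + rho t u.
Hypothesis rho_le : forall s t, rho s t <= d s t / 2.
Hypothesis J0 : J d mu b @[b --> 0^'+] --> 0%E.
Variables (y : T -> R) (C : R).
Hypothesis C_ge0 : 0 <= C.
Hypothesis y_bound : forall b j p q, 0 < b -> (J d mu b <= j%:E)%E ->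
  rho p q < 2 * b -> `|y p - y q| <= 5 / 4 * (22 * j + 10 * b * C).

Let mB := measurable_dball d_cont.

Lemma path_bounded : exists M : R, forall t, `|y t| <= M.
Proof.
have [c c0 Jc] := J_small J0 ltr01.
pose b := c / 2; have b0 : 0 < b by rewrite divr_gt0.
have Jb : (J d mu b <= 1%:E)%E by apply: Jc; rewrite b0 /b; lra.
(* The first term of the dyadic sum, [b] times the root of the log of the inverse mass, is at most
   [2]; solving for the mass gives this uniform lower bound, so finitely many centres control the
   whole path. *)
pose e := expR (- (2 / b) ^+ 2).
have eA t : (e%:E <= mu (dball d t b))%E.
  have m0 : 0 < fine (mu (dball d t b)).
    by apply: (dball_mass_gt0 mB b0) => //; apply: le_lt_trans Jb _; rewrite ltry.
  have := dyadic_entropy_sum mB b0 Jb t 1.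
  rewrite big_ord_recl big_ord0 expr0 divr1 addr0 mulr1 => h.
  rewrite -(fineK (fin_num_measure mu _ (mB t b))) lee_fin.
  rewrite -[leRHS]lnK ?posrE// ler_expR lerNl -lnV ?posrE//.
  have [l0|l0] := leP 0 (ln (fine (mu (dball d t b)))^-1); last first.
    by apply: le_trans (ltW l0) _; exact: sqr_ge0.
  rewrite -[leLHS]sqr_sqrtr//.
  apply: lerXn2r; [exact: sqrtr_ge0|by rewrite nnegrE divr_ge0 ?(ltW b0)|].
  by rewrite ler_pdivlMr// mulrC.
have [F HF] := finite_intersecting_family (expR_gt0 _) (fun t => mB t b) eA.
have [M HM] : exists M, forall s, s \in F -> `|y s| <= M.
  elim: (F) => [|s l [M HM]]; first by exists 0.
  exists (Num.max M `|y s|) => x; rewrite inE le_max => /orP[/eqP ->|/HM ->//].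
  by rewrite lexx orbT.
exists (M + 5 / 4 * (22 * 1 + 10 * b * C)) => t.
have [s sF [x [tx sx]]] := HF t.
have dxt : d x t <= b := tx.
have dxs : d x s <= b := sx.
have ts : rho t s < 2 * b.
  have := rhoD t x s; have := rho_le x t; have := rho_le x s; rewrite (rhoC t x).
  lra.
rewrite -[y t](subrK (y s)) addrC; apply: le_trans (ler_normD _ _) _.
by rewrite lerD ?HM// y_bound.
Qed.

Let small_bound (e : R) : 0 < e -> exists b j : R,
  [/\ 0 < b, (J d mu b <= j%:E)%E & 5 / 4 * (22 * j + 10 * b * C) < e].
Proof. by move=> e0; exact: (small_J_bound J0 C_ge0). Qed.

Lemma path_continuous : continuous y.
Proof.
move=> t; apply/cvgrPdist_lt => e e0.
have [b [j [b0 Jb be]]] := small_bound e0.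
have b2 : 0 < 2 * b by rewrite mulr_gt0.
apply: filterS (near_pseudometric d_ge0 dxx d_cont rho_le t b2) => s st.
by apply: le_lt_trans be; apply: y_bound; rewrite // rhoC.
Qed.

Let path_eq s t : rho s t = 0 -> y s = y t.
Proof.
move=> st; apply/eqP; rewrite -subr_eq0 -normr_le0; apply/ler_addgt0Pr => e e0.
have [b [j [b0 Jb be]]] := small_bound e0.
rewrite add0r; apply: le_trans (ltW be); apply: y_bound => //.
by rewrite st mulr_gt0.
Qed.

Lemma path_modulus : exists2 c : R, 0 < c & forall delta, 0 < delta < c ->
  (modulus_ratio d mu (fun x => y x ^+ 2)%R delta <=
   60%:E * sqrte (ereal_sup [set (y x ^+ 2)%R%:E | x in [set: T]]))%E.
Proof.
have [M HM] := path_bounded.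
set S := ereal_sup _.
have S_ge x : ((y x ^+ 2)%:E <= S)%E by apply: ereal_sup_ubound; exists x.
have S0 : (0 <= S)%E by apply: le_trans (S_ge point); rewrite lee_fin sqr_ge0.
have SM : (S <= (M ^+ 2)%:E)%E.
  apply: ge_ereal_sup => _ [x _ <-]; rewrite lee_fin.
  rewrite -(real_normK (num_real (y x))) lerXn2r ?nnegrE//.
  by apply: le_trans (HM x).
have Sfin : S \is a fin_num.
  by rewrite ge0_fin_numE//; apply: le_lt_trans SM _; rewrite ltry.
pose q := Num.sqrt (fine S).
have -> : (60%:E * sqrte S = (60 * q)%:E)%E by rewrite -(fineK Sfin) EFinM.
have yq x : `|y x| <= q.
  by rewrite -sqrtr_sqr ler_wsqrtr// -lee_fin fineK.
have q0 : 0 <= q by exact: sqrtr_ge0.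
have q60 : (0 <= (60 * q)%:E)%E by rewrite lee_fin mulr_ge0.
have [c1 c10 J1] := J_small J0 ltr01.
have zero s t : rho s t = 0 ->
    (`|y s ^+ 2 - y t ^+ 2|%:E / J d mu (d s t / 2) <= (60 * q)%:E)%E.
  by move=> st; rewrite (path_eq st) subrr normr0 mul0e.
have [HJ|[e e0 He]] := entropy_dichotomy mu mB rho_ge0 rhoC rhoD rho_le; last first.
  exists e => // delta /andP[_ de]; apply: ge_ereal_sup => _ [[s t] /= st <-].
  apply: zero; apply: He; have := rho_le s t; have := d_ge0 s t; lra.
(* With [5 C b <= j] the term [10 b C] is at most [2 j], so the increment is at most
   [5/4 * 24 j = 30 j]; the factor [|y s + y t| <= 2 q] then gives [60]. *)
have [c c0 Hc] := HJ (5 * C).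
exists (Num.min c c1); first by rewrite lt_min c0.
move=> delta; rewrite lt_min => /andP[_ /andP[dc dc1]].
apply: ge_ereal_sup => _ [[s t] /= st <-].
have [dst|dst] := leP (d s t) 0.
  by apply: zero; apply/eqP; rewrite eq_le rho_ge0 andbT; have := rho_le s t; lra.
set b := d s t / 2; have b0 : 0 < b by rewrite divr_gt0.
have bd : b < d s t by rewrite /b; lra.
have Jb1 : (J d mu b <= 1%:E)%E by apply: J1; rewrite b0; lra.
have Jfin : J d mu b \is a fin_num.
  by rewrite ge0_fin_numE ?J_ge0//; apply: le_lt_trans Jb1 _; rewrite ltry.
pose j := fine (J d mu b).
have jE : J d mu b = j%:E by rewrite fineK.
have j0 : 0 <= j by rewrite -lee_fin -jE J_ge0.
have Cj : 5 * C * b <= j by rewrite -lee_fin -jE; apply: Hc; rewrite b0; lra.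
have yst : `|y s - y t| <= 30 * j.
  apply: le_trans (y_bound b0 _ _) _; first by rewrite jE.
    by have := rho_le s t; rewrite -/b; lra.
  by lra.
have y2 : `|y s ^+ 2 - y t ^+ 2| <= 60 * q * j.
  rewrite subr_sqr normrM.
  have sq : `|y s + y t| <= 2 * q.
    by apply: le_trans (ler_normD _ _) _; have := yq s; have := yq t; lra.
  apply: le_trans (ler_pM _ _ yst sq) _ => //; lra.
(* If [J] vanishes, the bound [60 * q * j] forces equal squares, and the ratio is [0 / 0 = 0]. *)
rewrite jE; have [j00|j00] := eqVneq j 0.
  move: y2; rewrite j00 mulr0 normr_le0 => /eqP ->.
  by rewrite normr0 mul0e.
rewrite inver (negbTE j00) -EFinM lee_fin ler_pdivrMr//.
by rewrite lt_def j00.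
Qed.

End path_modulus.

Lemma modulus_ratio_nondecreasing (R : realType) (T : ptopologicalType)
    (d : T -> T -> R) (mu : probability (borelType T) R) (f : T -> R) (a b : R) :
  a <= b -> (modulus_ratio d mu f a <= modulus_ratio d mu f b)%E.
Proof.
move=> ab; apply: ereal_sup_le => _ [st sta <-].
by exists st => //; exact: le_trans ab.
Qed.

Lemma ae_eq_probability1 (R : realType) d0 (O : measurableType d0)
    (P : probability O R) (f g : {RV P >-> R}) :
  {ae P, forall w, f w = g w} -> P [set w | f w = g w] = 1%E.
Proof.
move=> [N [mN PN subN]].
have mfg : measurable [set w | f w = g w].
  rewrite (_ : [set w | _] = setT `&` (fun w => f w == g w) @^-1` [set true]).
    by apply: measurable_fun_eqr.
  by rewrite setTI; apply/seteqP; split => w /= /eqP.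
have P0 : P (~` [set w | f w = g w]) = 0%E.
  by apply: subset_measure0 subN PN => //; exact: measurableC.
have fin : P [set w | f w = g w] \is a fin_num by rewrite fin_num_measure.
have := probability_setC P mfg; rewrite [X in X = _]P0 -(fineK fin) -EFinB => -[p1].
by congr EFin; lra.
Qed.

Theorem theorem1p1 (R : realType) (dO : measure_display)
    (Omega : measurableType dO) (P : probability Omega R)
    (T : ptopologicalType) (Gamma : T -> T -> R) (theta : T -> {RV P >-> R}) :
  separable_space T ->
  permanental_process Gamma theta ->
  (ereal_sup [set (Gamma x x)%:E | x in [set: T]] < +oo)%E ->
  continuous (fun xy : T * T => kernel_dist Gamma xy.1 xy.2) ->
  forall mu : probability (borelType T) R,
  J (kernel_dist Gamma) mu delta @[delta --> 0^'+] --> 0%E ->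
  exists theta' : T -> {RV P >-> R},
    [/\ is_version theta' theta,
        {ae P, forall w, [bounded theta' x w | x in [set: T]] /\
                         continuous (fun x => theta' x w)} &
        {ae P, forall w, exists2 l : \bar R,
          modulus_ratio (kernel_dist Gamma) mu (fun x => theta' x w) delta
            @[delta --> 0^'+] --> l &
          (l <= 60%:E * sqrte (ereal_sup [set (theta' x w)%:E | x in [set: T]]))%E}].
Proof.
move=> sepT perm _ d_cont mu J0.
have theta_ge0 x w : 0 <= theta x w by case: perm.
set d := kernel_dist Gamma in d_cont J0 *.
have d_ge0 s t : 0 <= d s t by rewrite !mulr_ge0 ?sqrtr_ge0.
have dxx t : d t t = 0.
  (* Nonnegativity makes the root of [Gamma t t ^+ 2] equal to [Gamma t t], so that the terms in
     [d t t] cancel. *)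
  have G0 : 0 <= Gamma t t.
    by apply: (laplace2_diag_ge0 _ _ (permanental_laplace2 perm t t)).
  rewrite /d /kernel_dist -expr2 sqrtr_sqr ger0_norm//.
  by rewrite (_ : _ - _ = 0) ?sqrtr0 ?mulr0//; ring.
pose X t w := Num.sqrt (theta t w).
have mX t : measurable_fun setT (X t).
  apply: (@measurableT_comp _ _ _ _ _ _ (@Num.sqrt R)) => //.
  by apply: continuous_measurable_fun; exact: sqrt_continuous.
have Xd s t (c : R) : 0 < c -> d s t <= 2 * c ->
    (\int[P]_w (expR (((X s w - X t w) / c) ^+ 2))%:E <= 2%:E)%E.
  exact: permanental_sqrt_increment.
have mB := measurable_dball d_cont.
have : exists2 rho : T -> T -> R, [/\ forall s t, 0 <= rho s t,
    forall s t, rho s t = rho t s,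
    forall s t u, rho s u <= rho s t + rho t u &
    forall s t, rho s t <= d s t / 2] &
    forall s : nat -> T, {ae P, forall w, exists2 C : R, 0 <= C &
      forall b j p q, 0 < b -> (J d mu b <= j%:E)%E -> rho (s p) (s q) <= 2 * b ->
      `|X (s p) w - X (s q) w| <= 5 / 4 * (22 * j + 10 * b * C)}.
  exists (psi2_dist P X); first split.
  - exact: psi2_dist_ge0 d_ge0 Xd.
  - exact: psi2_distC.
  - exact: (psi2_distD mX d_ge0 Xd).
  - exact: (psi2_dist_le d_ge0 Xd).
  - move=> s; apply: (as_chaining mu mX d_ge0 Xd mB) => a.
    apply: (pseudometric_continuous d_ge0 dxx d_cont).
    + exact: psi2_distC.
    + exact: (psi2_distD mX d_ge0 Xd).
    + exact: (psi2_dist_le d_ge0 Xd).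
move=> [rho [rho_ge0 rhoC rhoD rho_le] rho_chain].
have [Y [mY YX Yb]] := continuous_version d_ge0 dxx d_cont rhoC rhoD rho_le J0 mX
  sepT rho_chain.
have mY2 t : measurable_fun setT (fun w => Y t w ^+ 2) by exact: measurable_funX.
pose theta' t : {RV P >-> R} := mfun_Sub (mem_set (mY2 t)).
have theta'E t w : theta' t w = Y t w ^+ 2 by [].
exists theta'; split.
- move=> t; apply: ae_eq_probability1; apply: filterS (YX t) => w Yw.
  by rewrite theta'E Yw sqr_sqrtr.
- apply: filterS Yb => w [C C0 HC]; split; last first.
    move=> t; rewrite (_ : (fun x => _) = fun x => Y x w ^+ 2)//.
    have Yc := path_continuous d_ge0 dxx d_cont rhoC rho_le J0 C0 HC.
    by apply: (@continuous_comp _ _ _ (Y^~ w) (fun z => z ^+ 2));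
      [exact: Yc|exact: exprn_continuous].
  have [M HM] := path_bounded d_cont rhoC rhoD rho_le J0 HC.
  exists (M ^+ 2); split; first exact: num_real.
  move=> N MN t _; change (`|Y t w ^+ 2| <= N); rewrite normrX.
  apply: le_trans (ltW MN).
  by rewrite lerXn2r ?nnegrE//; apply: le_trans (HM t).
- apply: filterS Yb => w [C C0 HC].
  have [c c0 Hc] := path_modulus d_ge0 d_cont rho_ge0 rhoC rhoD rho_le J0 C0 HC.
  (* The ratio is nondecreasing in [delta], so its limit at [0] from the right exists and is the
     infimum over []0, c[]; its value at [c / 2] bounds the limit. *)
  exists (ereal_inf (modulus_ratio d mu (fun x => theta' x w) @` `]0, c[%classic)).
    apply: (@nondecreasing_at_right_cvge _ _ 0 (BLeft c)); first by rewrite bnd_simp.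
    by move=> a b _ _; exact: modulus_ratio_nondecreasing.
  apply: le_trans (Hc (c / 2) _); last by lra.
  apply: ereal_inf_lbound; exists (c / 2) => //=.
  by rewrite in_itv/=; lra.
Qed.
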